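(* Let $\mu$ be a positive regular Borel measure on $\mathbb{C}_+$, let $\alpha>1$, and let $\Phi_\alpha(t)=\exp(t^\alpha)-t^\alpha-1$ for $t\ge0$. Then $\mathcal{L}\colon L^{\Phi_\alpha}(0,1)\to L^2(\mathbb{C}_+,\mu)$ is bounded if and only if $$\sum_{n=1}^\infty n^{2/\alpha}\,\mathcal{C}_2[\mu_n]+\sup_{I\subset i\mathbb{R}\text{ interval},\,|I|=2}\mu(Q_I)<\infty,$$ with an associated equivalence of norms (the left-hand side is comparable to the square of the norm of the embedding, with constants independent of $\mu$).
   Context: $\mathbb{C}_+=\{z\in\mathbb{C}:\operatorname{Re}z>0\}$. The Laplace transform of a function $f$ on $(0,\infty)$ is $\mathcal{L}f(z)=\int_0^\infty e^{-zt}f(t)\,dt$, $z\in\mathbb{C}_+$; a function on $(0,1)$ is extended by $0$ to $(0,\infty)$. For a function $\Phi$ such as $\Phi_\alpha$, $L^\Phi(0,1)$ is the Orlicz space of measurable $f\colon(0,1)\to\mathbb{C}$ for which $\Phi(k^{-1}|f|)$ is integrable for some $k>0$, with norm $\|f\|_{L^\Phi}=\inf\{k>0:\int_0^1\Phi(k^{-1}|f(s)|)\,ds\le1\}$. For an interval $I\subset i\mathbb{R}$ with length $|I|\in(0,\infty)$, $Q_I=\{x+iy: iy\in I,\ 0<x\le|I|\}$. For a positive regular Borel measure $\mu$ on $\mathbb{C}_+$ and $\beta>0$, $\mathcal{C}_\beta[\mu]=\sup_{I}\mu(Q_I)/|I|^\beta$, the supremum over all intervals $I\subset i\mathbb{R}$.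 For $n\in\mathbb{Z}$ let $S_n=\{x+iy: y\in\mathbb{R},\ 2^n\le x<2^{n+1}\}$ and $\mu_n(E)=\mu(E\cap S_n)$. *)

(* Defs.v *)
From HB Require Import structures.
From mathcomp Require Import all_boot all_order all_algebra.
From mathcomp Require Import complex.
From mathcomp Require Import all_classical all_reals all_analysis.

Set Implicit Arguments.
Unset Strict Implicit.
Unset Printing Implicit Defensive.

Import Order.TTheory GRing.Theory Num.Theory.
Import numFieldNormedType.Exports.

Local Open Scope classical_set_scope.
Local Open Scope ring_scope.
Local Open Scope complex_scope.

(* [R[i]^o] carries the norm topology of the complex field; [Cborel R] is the
   same carrier equipped with the Borel sigma-algebra of that topology. *)
Definition Cborel (R : realType) : measurableType (@open R[i]^o).-sigma :=
  g_sigma_algebraType (@open R[i]^o).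

(* Real-valued modulus: [`|z|] would have type [R[i]]. *)
Definition cmod (R : realType) (z : R[i]) : R :=
  Num.sqrt (complex.Re z ^+ 2 + complex.Im z ^+ 2).

Definition cexp (R : realType) (z : R[i]) : R[i] :=
  (expR (complex.Re z) * cos (complex.Im z)) +i*
  (expR (complex.Re z) * sin (complex.Im z)).

Definition Cintegral (R : realType) (D : set R) (f : R -> R[i]) : R[i] :=
  (\int[@lebesgue_measure R]_(t in D) complex.Re (f t)) +i*
  (\int[@lebesgue_measure R]_(t in D) complex.Im (f t)).

Definition Cplus (R : realType) : set (Cborel R) :=
  [set z | 0 < complex.Re z].

Definition extend0 (R : realType) (f : R -> R[i]) (t : R) : R[i] :=
  if t \in `]0, 1[ then f t else 0.

Definition Laplace (R : realType) (f : R -> R[i]) (z : R[i]) : R[i] :=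
  Cintegral `]0, +oo[ (fun t => cexp (- (z * t%:C)) * f t).

Definition Phi (R : realType) (alpha t : R) : R :=
  expR (t `^ alpha) - t `^ alpha - 1.

Definition Orlicz (R : realType) (Ph : R -> R) (f : R -> Cborel R) : Prop :=
  measurable_fun (`]0, 1[ : set R) f /\
  exists2 k : R, 0 < k &
    (@lebesgue_measure R).-integrable (`]0, 1[ : set R)
      (fun s => (Ph (k^-1 * cmod (f s)))%:E).

Definition Orlicz_norm (R : realType) (Ph : R -> R) (f : R -> Cborel R) : R :=
  inf [set k : R | 0 < k /\
    (\int[@lebesgue_measure R]_(s in (`]0%R, 1%R[ : set R)) (Ph (k^-1 * cmod (f s)))%:E
       <= 1)%E].

Section measures.
Context {R : realType}.

(* Borel measures on C_+ are represented by Borel measures on C carried by C_+;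
   regularity refers to the topology of the open subspace C_+. *)
Definition carried_by_Cplus (mu : {measure set (Cborel R) -> \bar R}) : Prop :=
  mu (~` @Cplus R) = 0%E.

Definition regular_on_Cplus (mu : {measure set (Cborel R) -> \bar R}) : Prop :=
  forall E : set (Cborel R), measurable E -> E `<=` @Cplus R ->
    mu E = ereal_inf [set mu U | U in [set U : set R[i]^o |
             [/\ open U, E `<=` U & U `<=` @Cplus R]]] /\
    mu E = ereal_sup [set mu K | K in [set K : set R[i]^o |
             compact K /\ K `<=` E]].

(* The subset I of i R is represented by the set of y with iy in I. *)
Definition ilength (I : set R) : R := fine (@lebesgue_measure R I).

Definition bounded_interval (I : set R) : Prop :=
  is_interval I /\ (0 < @lebesgue_measure R I < +oo)%E.

Definition Qbox (I : set R) : set (Cborel R) :=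
  [set z | I (complex.Im z) /\ 0 < complex.Re z <= ilength I].

Definition carleson (beta : R) (nu : set (Cborel R) -> \bar R) : \bar R :=
  ereal_sup [set (nu (Qbox I) * ((ilength I `^ beta)^-1)%:E)%E |
              I in bounded_interval].

Definition strip (n : int) : set (Cborel R) :=
  [set z | (2 : R) ^ n <= complex.Re z < (2 : R) ^ (n + 1)].

Definition strip_part (mu : set (Cborel R) -> \bar R) (n : int) :
    set (Cborel R) -> \bar R :=
  fun E => mu (E `&` strip n).

Definition L2norm (mu : {measure set (Cborel R) -> \bar R})
    (F : Cborel R -> Cborel R) : \bar R :=
  Lnorm mu 2%:E (fun z => (cmod (F z))%:E).

Definition Laplace_bound (Ph : R -> R)
    (mu : {measure set (Cborel R) -> \bar R}) (M : R) : Prop :=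
  forall f : R -> Cborel R, Orlicz Ph f ->
    measurable_fun (@Cplus R) (Laplace (extend0 f) : Cborel R -> Cborel R) /\
    (L2norm mu (Laplace (extend0 f)) <= (M * Orlicz_norm Ph f)%:E)%E.

Definition Laplace_bounded (Ph : R -> R)
    (mu : {measure set (Cborel R) -> \bar R}) : Prop :=
  exists2 M : R, 0 <= M & Laplace_bound Ph mu M.

(* Operator norm of the Laplace transform from L^Ph(0,1) to L^2(C_+, mu);
   it is +oo when the transform is unbounded. *)
Definition Laplace_opnorm (Ph : R -> R)
    (mu : {measure set (Cborel R) -> \bar R}) : \bar R :=
  ereal_inf [set M%:E | M in [set M : R | 0 <= M /\ Laplace_bound Ph mu M]].

Definition carleson_testing (alpha : R) (mu : {measure set (Cborel R) -> \bar R}) :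
    \bar R :=
  (\sum_(1 <= n <oo)
      ((n%:R `^ (2 / alpha))%:E * carleson 2 (strip_part mu n%:Z))
   + ereal_sup [set mu (Qbox I) |
       I in [set I | bounded_interval I /\ ilength I = 2%R]])%E.

End measures.

(* Main.v *)
From HB Require Import structures.
Require Import Defs.
From mathcomp Require Import all_boot all_order all_algebra.
From mathcomp Require Import complex.
From mathcomp Require Import all_classical all_reals all_analysis.
From mathcomp Require Import measurable_realfun.
From mathcomp Require Import ring lra.

(** The integral of |L f|^2 over the half-plane is split over the strips
2^n <= Re z < 2^(n+1), the first one being 0 < Re z < 2.

Upper bound. Let N = 2^n. When Re z has size N, the kernel exp(- z t) decays by a
constant factor from one piece [j pi / N, (j + 1) pi / N] to the next. For Im z in a
window [2 N k, 2 N (k + 1)] it is, on each piece, the trigonometric function of frequency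
2 N k times a smooth factor; integrating by parts removes that factor
([sqr_Rintegral_parts]) and leaves a bound that does not depend on z in the cell. The
frequencies 2 N k are orthogonal on each piece, so Bessel's inequality makes these bounds
summable over k ([sum_piece_coef], [sum_cell_coef]): the sum over k of the suprema of
|L f|^2 on the cells is at most of order 1 / N times the largest mass of |f|^2 on a piece.
If f has Orlicz norm at most 1, that mass is at most of order n^(2/alpha) / N
([sqr_le_Phi], [component_piece]). As a cell has measure at most of order
N^2 C_2[mu_n], the n-th strip contributes at most a constant times
n^(2/alpha) C_2[mu_n] ([integral_level_Laplace]).

Lower bound. For every n take a bump of height (n + 1)^(1/alpha) on the dyadic interval
]2^-(n+1), 2^-n[, modulated at a frequency y_n. Sums of such bumps have bounded Orlicz norm
for all signs ([unit_modular_test_fun]). The transform of the n-th bump has size at least of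
order (n + 1)^(1/alpha) 2^-n on the box of side 2^n at height y_n in the n-th strip
([bump_re_ge]). The bumps interfere, but for suitable signs the square norm of the
sum is at least the sum of the square norms ([parallelogram_signs]). Hence
\sum_n (n + 1)^(2/alpha) 4^-n mu(box_n(y_n)) is bounded for all heights y_n
([sum_level_box_le]), and each y_n can be chosen to realise half of the supremum over the
boxes of the n-th strip, which is at least of order 4^n C_2[mu_n] ([carleson_strip_le]).

The first strip is treated in the same way, and gives the term with |I| = 2. *)

Set Implicit Arguments.
Unset Strict Implicit.
Unset Printing Implicit Defensive.
Import Order.TTheory GRing.Theory Num.Theory.
Import numFieldNormedType.Exports.
Local Open Scope classical_set_scope.
Local Open Scope ring_scope.

(** * Square integrable functions on a segment and Bessel's inequality *)

Section square_integrable.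
Context {R : realType}.
Notation mu := (@lebesgue_measure R).
Implicit Types (a b M : R) (f g h : R -> R).

(** Real functions that are square integrable on [[a, b]]. *)
Definition sqint a b g :=
  measurable_fun `[a, b] g /\
  mu.-integrable `[a, b] (EFin \o (fun t => g t ^+ 2)).

Lemma integrable_addr a b g h : mu.-integrable `[a, b] (EFin \o g) ->
  mu.-integrable `[a, b] (EFin \o h) ->
  mu.-integrable `[a, b] (EFin \o (fun t => g t + h t)).
Proof. by move=> ig ih; apply: (@integrableD _ _ _ mu _ _ (EFin \o g) (EFin \o h)). Qed.

Lemma integrable_mull a b (c : R) h : mu.-integrable `[a, b] (EFin \o h) ->
  mu.-integrable `[a, b] (EFin \o (fun t => c * h t)).
Proof. by move=> ih; apply: (integrableZl _ c ih). Qed.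

Lemma integrable_bounded_itv a b g M : measurable_fun `[a, b] g ->
  (forall t, t \in `[a, b] -> `|g t| <= M) ->
  mu.-integrable `[a, b] (EFin \o g).
Proof.
move=> mg gM; apply: measurable_bounded_integrable => //.
- rewrite /= lebesgue_measure_itv/=; case: ifPn => // _.
  by rewrite -EFinB ltry.
- exists M; split; first exact: num_real.
  by move=> x Mx t tab /=; apply: le_trans (ltW Mx); exact: gM.
Qed.

Lemma integrable_le_itv a b g h : measurable_fun `[a, b] g ->
  mu.-integrable `[a, b] (EFin \o h) ->
  (forall t, t \in `[a, b] -> `|g t| <= h t) ->
  mu.-integrable `[a, b] (EFin \o g).
Proof.
move=> mg ih gh; apply: (le_integrable _ _ _ ih) => //.
- exact/measurable_EFinP.
- by move=> t tab /=; rewrite lee_fin (le_trans (gh _ tab))// ler_norm.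
Qed.

Lemma sqint_mul a b g h : sqint a b g -> sqint a b h ->
  mu.-integrable `[a, b] (EFin \o (fun t => g t * h t)).
Proof.
move=> [mg ig] [mh ih]; have igh := integrable_addr ig ih.
apply: (integrable_le_itv _ igh); first exact: measurable_funM.
move=> t _ /=; rewrite normrM.
have := sqr_ge0 (`|g t| - `|h t|); rewrite sqrrB !real_normK ?num_real//.
have := sqr_ge0 (g t); have := sqr_ge0 (h t); nra.
Qed.

Lemma sqint_bounded a b g M : measurable_fun `[a, b] g ->
  (forall t, t \in `[a, b] -> `|g t| <= M) -> sqint a b g.
Proof.
move=> mg gM; split=> //; apply: (@integrable_bounded_itv _ _ _ (M ^+ 2)).
  exact: measurable_funX.
move=> t tab; rewrite normrX ler_sqr ?nnegrE ?gM//.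
by rewrite (le_trans _ (gM _ tab)).
Qed.

Lemma sqint_mul_bounded a b g h M : sqint a b g -> measurable_fun `[a, b] h ->
  (forall t, t \in `[a, b] -> `|h t| <= M) -> sqint a b (fun t => g t * h t).
Proof.
move=> [mg ig] mh hM; split; first exact: measurable_funM.
apply: (@integrable_le_itv _ _ _ (fun t => M ^+ 2 * g t ^+ 2)).
- by apply: measurable_funX; exact: measurable_funM.
- exact: integrable_mull.
- move=> t tab; rewrite ger0_norm ?sqr_ge0// exprMn mulrC.
  rewrite ler_wpM2r ?sqr_ge0// -(real_normK (num_real (h t))).
  by rewrite ler_sqr ?nnegrE ?hM// (le_trans _ (hM _ tab)).
Qed.

Lemma sqint_int a b g : sqint a b g -> mu.-integrable `[a, b] (EFin \o g).
Proof.
move=> sg; have s1 : sqint a b (cst 1).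
  by apply: (@sqint_bounded _ _ _ 1) => // t _ /=; rewrite normr1.
by have := sqint_mul sg s1; under [X in _.-integrable _ X]funext do rewrite /= mulr1.
Qed.

Lemma sqintD a b g h : sqint a b g -> sqint a b h ->
  sqint a b (fun t => g t + h t).
Proof.
move=> sg sh; have igh := sqint_mul sg sh; case: sg sh => [mg ig] [mh ih].
split; first exact: measurable_funD.
have := integrable_addr (integrable_addr ig ih) (integrable_mull 2 igh).
congr (_.-integrable _ _); apply/funext => t /=.
by rewrite sqrrD mulr_natl addrAC.
Qed.

Lemma sqintZ a b g (c : R) : sqint a b g -> sqint a b (fun t => c * g t).
Proof.
move=> sg; have := @sqint_mul_bounded _ _ _ (cst c) `|c| sg.
under [X in sqint _ _ X]funext do rewrite mulrC.
by apply.
Qed.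

Lemma sqintS a b c d g : a <= c -> d <= b -> sqint a b g -> sqint c d g.
Proof.
move=> ac db [mg ig]; have sub : `[c, d] `<=` `[a, b].
  by apply: subset_itv; rewrite bnd_simp.
split; first exact: measurable_funS mg.
exact: integrableS ig.
Qed.

Lemma RintegralDr a b g h : mu.-integrable `[a, b] (EFin \o g) ->
  mu.-integrable `[a, b] (EFin \o h) -> forall c,
  \int[mu]_(t in `[a, b]) (g t + c * h t) =
  \int[mu]_(t in `[a, b]) g t + c * \int[mu]_(t in `[a, b]) h t.
Proof.
move=> ig ih c; rewrite RintegralD ?RintegralZl//.
exact: integrable_mull.
Qed.

(** Bessel's inequality for an orthogonal family of functions bounded by 1, hence
of squared norm at most b - a. The proof follows the residual
(b - a) g - \sum_(k < K) c_k e_k, where c_k is the k-th coefficient of g. *)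
Lemma bessel a b (e : nat -> R -> R) g K : a < b ->
  (forall k, measurable_fun `[a, b] (e k)) ->
  (forall k t, `|e k t| <= 1) ->
  (forall j k, (j < k)%N -> \int[mu]_(t in `[a, b]) (e j t * e k t) = 0) ->
  sqint a b g ->
  \sum_(k < K) (\int[mu]_(t in `[a, b]) (g t * e k t)) ^+ 2 <=
  (b - a) * \int[mu]_(t in `[a, b]) g t ^+ 2.
Proof.
move=> ab me be orth sg.
set L := b - a; have L0 : 0 < L by rewrite subr_gt0.
have se k : sqint a b (e k) by apply: (@sqint_bounded _ _ _ 1).
pose c k := \int[mu]_(t in `[a, b]) (g t * e k t).
have ee k : \int[mu]_(t in `[a, b]) (e k t * e k t) <= L.
  have -> : L = \int[mu]_(t in `[a, b]) (cst 1 t).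
    rewrite Rintegral_cst// mul1r /= lebesgue_measure_itv/= lte_fin ab/=.
    by [].
  apply: le_Rintegral => //; first exact: sqint_mul.
    by apply: (@integrable_bounded_itv _ _ _ 1) => // t _; rewrite normr1.
  move=> t _ /=; rewrite -expr2 -(real_normK (num_real (e k t))).
  by rewrite -[leRHS](expr1n _ 2) ler_sqr ?nnegrE.
(* The residual after K steps. *)
suff [r [sr _]] : exists r, [/\ sqint a b r,
    forall m, (K <= m)%N -> \int[mu]_(t in `[a, b]) (r t * e m t) = L * c m &
    \int[mu]_(t in `[a, b]) (r t * r t) <=
      L ^+ 2 * (\int[mu]_(t in `[a, b]) (g t * g t)) - L * \sum_(k < K) c k ^+ 2].
  rewrite [X in _ <= _ * X](_ : _ = \int[mu]_(t in `[a, b]) (g t * g t)); last first.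
    by apply: eq_Rintegral => t _; rewrite expr2.
  have : 0 <= \int[mu]_(t in `[a, b]) (r t * r t).
    by apply: Rintegral_ge0 => t _; rewrite -expr2 sqr_ge0.
  move=> /le_trans /[apply]; rewrite subr_ge0 expr2 -mulrA ler_pM2l//.
elim: K => [|K [r [sr rm rr]]].
  exists (fun t => L * g t); split; first exact: sqintZ.
    move=> m _; rewrite -RintegralZl//; last exact: sqint_mul.
    by apply: eq_Rintegral => t _; rewrite mulrA.
  rewrite big_ord0 mulr0 subr0 -RintegralZl//; last exact: sqint_mul.
  by rewrite le_eqVlt; apply/orP; left; apply/eqP/eq_Rintegral => t _; rewrite expr2 mulrACA.
exists (fun t => r t + (- c K) * e K t); split.
- by apply: sqintD => //; exact: sqintZ.
- move=> m Km; transitivity (\int[mu]_(t in `[a, b]) (r t * e m t + (- c K) * (e K t * e m t))).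
    by apply: eq_Rintegral => t _; rewrite mulrDl mulrA.
  rewrite RintegralDr; [|exact: sqint_mul|exact: sqint_mul].
  by rewrite orth// mulr0 addr0 rm// ltnW.
- rewrite [leLHS](_ : _ = \int[mu]_(t in `[a, b]) (r t * r t +
      (- (2 * c K)) * (r t * e K t)) + c K ^+ 2 *
      \int[mu]_(t in `[a, b]) (e K t * e K t)); last first.
    rewrite -RintegralDr; last 2 first.
      apply: (integrable_addr (sqint_mul sr sr)).
      by apply: integrable_mull; exact: sqint_mul.
      exact: sqint_mul.
    by apply: eq_Rintegral => t _; ring.
  rewrite RintegralDr; [|exact: sqint_mul|exact: sqint_mul].
  rewrite rm// big_ord_recr/= -/(c K).
  have := ler_wpM2l (sqr_ge0 (c K)) (ee K); move: rr.
  move: (\int[mu]_(t in _) _) (\int[mu]_(t in _) _) (\int[mu]_(t in _) _) (\sum_(_ < _) _) (c K).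
  by move=> A G S E d; lra.
Qed.

(** The Cauchy-Schwarz inequality against the constant 1. *)
Lemma sqr_Rintegral_le a b g : a < b -> sqint a b g ->
  (\int[mu]_(t in `[a, b]) g t) ^+ 2 <=
  (b - a) * \int[mu]_(t in `[a, b]) g t ^+ 2.
Proof.
move=> ab sg.
have := @bessel a b (fun k => if k is 0%N then cst 1 else cst 0) g 1 ab.
rewrite big_ord1; under eq_Rintegral do rewrite /= mulr1.
apply => //.
- by case.
- by case=> [|k] t; rewrite ?normr1 ?normr0.
- move=> j [|k]// _; under eq_Rintegral do rewrite /= mulr0.
  by rewrite /Rintegral integral0.
Qed.

End square_integrable.

(** * Trigonometric families and integration by parts *)

Section calculus.
Context {R : realType}.
Notation mu := (@lebesgue_measure R).
Implicit Types (a b c t x w : R) (f g h phi dphi : R -> R).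

Lemma Rintegral_derive a b phi dphi : a <= b ->
  (forall t : R, is_derive t 1 phi (dphi t)) -> continuous dphi ->
  \int[mu]_(t in `[a, b]) dphi t = phi b - phi a.
Proof.
rewrite le_eqVlt => /predU1P[<- _ _|ab dp cp].
  by rewrite set_itv1 Rintegral_set1 subrr.
have cphi : continuous phi.
  by move=> t; apply: differentiable_continuous; apply/derivable1_diffP; exact: ex_derive.
rewrite /Rintegral (@continuous_FTC2 _ _ phi)//.
- exact: continuous_subspaceT.
- split; first by move=> t _; exact: ex_derive.
    exact/cvg_at_right_filter/cphi.
  exact/cvg_at_left_filter/cphi.
- by move=> t _; rewrite derive1E; apply: derive_val.
Qed.

Lemma is_derive_mull c t : is_derive t 1 (fun s : R => c * s) c.
Proof.
by have := @is_deriveZ R R _ id c t 1 1 (is_derive_id t 1); rewrite /GRing.scale/= mulr1.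
Qed.

Lemma is_derive_comp_mull c t phi dphi : (forall s : R, is_derive s 1 phi (dphi s)) ->
  is_derive t 1 (fun s : R => phi (c * s)) (c * dphi (c * t)).
Proof.
move=> dp; have := @is_derive1_comp R phi (fun s => c * s) t (dphi (c * t)) c (dp _) (is_derive_mull _ _).
by rewrite mulrC.
Qed.

Lemma continuous_comp_mull c phi : continuous phi -> continuous (fun s : R => phi (c * s)).
Proof.
move=> cp t; apply: (@continuous_comp _ _ _ (fun s => c * s) phi); last exact: cp.
by apply: mulrl_continuous.
Qed.

Lemma Rintegral_cos_period a b w m : a < b -> w * (b - a) = pi *+ 2 -> (0 < m)%N ->
  \int[mu]_(t in `[a, b]) cos (w * m%:R * t) = 0.
Proof.
move=> ab wab m0; set c := w * m%:R.
have w0 : w != 0.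
  by apply/eqP => w0; move: wab; rewrite w0 mul0r => /eqP; rewrite lt_eqF// mulrn_wgt0// pi_gt0.
have c0 : c != 0 by rewrite mulf_neq0// pnatr_eq0 -lt0n.
have dS t : is_derive t 1 (fun t => c^-1 * sin (c * t)) (cos (c * t)).
  have := @is_deriveZ R R _ _ c^-1 t 1 _ (@is_derive_comp_mull c t sin cos (@is_derive_sin R)).
  by rewrite /GRing.scale/= mulrA mulVf// mul1r.
rewrite (Rintegral_derive (ltW ab) dS).
- rewrite -mulrBr (_ : c * b = c * a + pi *+ 2 *+ m).
    by rewrite periodicn ?subrr ?mulr0//; exact: sinD2pi.
  by rewrite -wab -[in RHS]mulr_natr /c; ring.
- by apply: continuous_comp_mull; exact: continuous_cos.
Qed.

Lemma measurable_comp_mull (D : set R) c phi : continuous phi ->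
  measurable_fun D (fun t => phi (c * t)).
Proof.
move=> cp; apply: measurable_funTS; apply: continuous_measurable_fun.
exact: continuous_comp_mull.
Qed.

(** The sine for [true], the cosine for [false]. *)
Definition trig (s : bool) : R -> R := if s then sin else cos.

Lemma trig_le1 s t : `|trig s t| <= 1.
Proof. by case: s; [exact: sin_max|exact: cos_max]. Qed.

Lemma continuous_trig s : continuous (trig s).
Proof. by case: s; [exact: continuous_sin|exact: continuous_cos]. Qed.

Lemma trig_orthogonal s a b w j k : a < b -> w * (b - a) = pi *+ 2 -> (j < k)%N ->
  \int[mu]_(t in `[a, b]) (trig s (w * j%:R * t) * trig s (w * k%:R * t)) = 0.
Proof.
move=> ab wab jk.
pose g m t := cos (w * m%:R * t).
have ig m : mu.-integrable `[a, b] (EFin \o g m).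
  apply: (@integrable_bounded_itv _ _ _ _ 1).
    by apply: measurable_comp_mull; exact: continuous_cos.
  by move=> t _; exact: cos_max.
pose e : R := if s then -1 else 1.
transitivity (2^-1 * \int[mu]_(t in `[a, b]) (g (k - j)%N t + e * g (k + j)%N t)).
  rewrite -RintegralZl//; last by apply: integrable_addr => //; exact: integrable_mull.
  apply: eq_Rintegral => t _.
  rewrite /g natrB ?(ltnW jk)//.
  rewrite natrD.
  have -> : w * (k%:R - j%:R) * t = w * k%:R * t - w * j%:R * t by ring.
  have -> : w * (k%:R + j%:R) * t = w * k%:R * t + w * j%:R * t by ring.
  rewrite cosB cosD.
  rewrite /e /trig; case: s {e}.
    by field.
  by field.
rewrite RintegralDr// !Rintegral_cos_period ?mulr0 ?addr0 ?mulr0//.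
- by rewrite addn_gt0 (leq_ltn_trans _ jk).
- by rewrite subn_gt0.
Qed.

(** Integration by parts when [h] is merely integrable: both sides are the iterated
integrals of dphi(s) h(t) over a <= t <= s <= b. *)
Lemma integration_by_parts_primitive a b h phi dphi : a <= b ->
  mu.-integrable `[a, b] (EFin \o h) ->
  (forall t : R, is_derive t 1 phi (dphi t)) -> continuous dphi ->
  \int[mu]_(t in `[a, b]) (h t * (phi b - phi t)) =
  \int[mu]_(s in `[a, b]) (dphi s * \int[mu]_(t in `[a, s]) h t).
Proof.
move=> ab ih dp cp.
(* Both factors are extended by 0 to the whole line. *)
pose h1 := h \_ `[a, b]; pose p1 := dphi \_ `[a, b].
have mh : measurable_fun setT h1.
  by apply/(measurable_restrictT h (measurable_itv _)); move/measurable_int: ih => /measurable_EFinP.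
have mp : measurable_fun setT p1.
  apply/(measurable_restrictT dphi (measurable_itv _)); apply: measurable_funTS.
  exact: continuous_measurable_fun.
pose f (z : measurableTypeR R * measurableTypeR R) : \bar R := (if z.2 <= z.1 then p1 z.1 * h1 z.2 else 0)%:E.
have mf : measurable_fun setT f.
  apply/measurable_EFinP; apply: measurable_fun_if => //.
  - by apply: measurable_fun_ler; [exact: measurable_snd|exact: measurable_fst].
  - apply: measurable_funTS; apply: measurable_funM.
      by apply: measurableT_comp => //; exact: measurable_fst.
    by apply: measurableT_comp => //; exact: measurable_snd.
have ih1 : mu.-integrable setT (EFin \o h1).
  by rewrite -restrict_EFin; apply/integrable_restrict => //=; rewrite setTI.
have ip1 : mu.-integrable setT (EFin \o p1).
  rewrite -restrict_EFin; apply/integrable_restrict => //=; rewrite setTI.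
  apply: continuous_compact_integrable; first exact: segment_compact.
  exact: continuous_subspaceT.
have intf : (mu \x mu)%E.-integrable setT f.
  apply/integrable12ltyP => //.
  apply: (@le_lt_trans _ _ (\int[mu]_x (`|(p1 x)%:E| * \int[mu]_y `|(h1 y)%:E|))%E).
    apply: ge0_le_integral => //.
    - by move=> x _; exact: integral_ge0.
    - apply: (measurable_fun_fubini_tonelli_F (abse \o f)).
        exact: measurableT_comp.
      by move=> x; exact: abse_ge0.
    - apply: (@emeasurable_funM _ _ _ _ (fun x => `|(p1 x)%:E|%E) (cst _)) => //.
      by apply: measurableT_comp => //; exact/measurable_EFinP.
    - move=> x _; rewrite -ge0_integralZl//; last first.
        by apply: measurableT_comp => //; exact/measurable_EFinP.
      apply: ge0_le_integral => //.
      + by apply: measurableT_comp => //; exact: measurableT_comp.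
      + apply: measurable_funeM.
        by apply: measurableT_comp => //; exact/measurable_EFinP.
      + move=> y _; rewrite /f/= lee_fin; case: ifPn => _; rewrite ?normrM// normr0 mulr_ge0//.
  have /integrableP[_ hoo] := ih1; have /integrableP[_ poo] := ip1.
  rewrite ge0_integralZr//; last 2 first.
    by apply: measurableT_comp => //; exact/measurable_EFinP.
    exact: integral_ge0.
  apply: lte_mul_pinfty; [exact: integral_ge0| |exact: hoo].
  by rewrite ge0_fin_numE//; exact: integral_ge0.
have := Fubini intf.
rewrite [X in X = _ -> _](_ : _ = \int[mu]_(s in `[a, b]) (dphi s * \int[mu]_(t in `[a, s]) h t)%:E)%E; last first.
  rewrite [RHS]integral_mkcond; apply: eq_integral => x _.
  rewrite patchE; case: ifPn => xab; last first.
    rewrite (_ : (fun y => f (x, y)) = cst 0%E) ?integral0//.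
    by apply/funext => y; rewrite /f/= /p1 patchE (negbTE xab) mul0r; case: ifP.
  have := xab; rewrite inE/= in_itv/= => /andP[ax xb].
  have ihx : mu.-integrable `[a, x] (EFin \o h).
    by apply: integrableS ih => //; apply: subset_itvl; rewrite bnd_simp.
  rewrite EFinM /Rintegral fineK; last exact: integrable_fin_num.
  rewrite -integralZl// [RHS]integral_mkcond; apply: eq_integral => y _.
  rewrite patchE /f/= /p1 patchE xab.
  case: ifPn => yx; case: ifPn => //.
  - by rewrite inE/= in_itv/= yx andbT => ay; rewrite /h1 patchE mem_set// /= in_itv/= ay (le_trans yx xb).
  - rewrite notin_setE/= in_itv/= yx andbT => ay; rewrite /h1 patchE memNset ?mulr0//=.
    by rewrite in_itv/= => /andP[].
  - by rewrite inE/= in_itv/= (negbTE yx) andbF.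
rewrite [X in _ = X -> _](_ : _ = \int[mu]_(t in `[a, b]) (h t * (phi b - phi t))%:E)%E; last first.
  rewrite [RHS]integral_mkcond; apply: eq_integral => y _.
  rewrite patchE; case: ifPn => yab; last first.
    rewrite (_ : (fun x => f (x, y)) = cst 0%E) ?integral0//.
    by apply/funext => x; rewrite /f/= /h1 patchE (negbTE yab) mulr0; case: ifP.
  have := yab; rewrite inE/= in_itv/= => /andP[ay yb].
  rewrite -(Rintegral_derive yb dp cp).
  have ipy : mu.-integrable `[y, b] (EFin \o dphi).
    apply: continuous_compact_integrable; first exact: segment_compact.
    exact: continuous_subspaceT.
  rewrite EFinM /Rintegral fineK; last exact: integrable_fin_num.
  rewrite -integralZl// [RHS]integral_mkcond; apply: eq_integral => x _.
  rewrite patchE /f/= /h1 patchE yab.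
  case: ifPn => yx; case: ifPn => //.
  - rewrite inE/= in_itv/= yx/= => xb; rewrite /p1 patchE mem_set/= ?in_itv/= ?xb ?(le_trans ay yx)//.
    by rewrite -EFinM mulrC.
  - rewrite notin_setE/= in_itv/= yx => /= xb; rewrite /p1 patchE memNset ?mul0r//=.
    by rewrite in_itv/= => /andP[].
  - by rewrite inE/= in_itv/= (negbTE yx).
by rewrite /Rintegral => ->.
Qed.

End calculus.

(** * Estimates on one piece of the segment *)

Section pieces.
Context {R : realType}.
Notation mu := (@lebesgue_measure R).
Implicit Types (a b c t x y w M E : R) (f g h u phi dphi : R -> R).

Lemma Rintegral_primitive_bounded a b h : mu.-integrable `[a, b] (EFin \o h) ->
  forall s, s \in `[a, b] ->
  `|\int[mu]_(t in `[a, s]) h t| <= \int[mu]_(t in `[a, b]) `|h t|.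
Proof.
move=> ih s; rewrite in_itv/= => /andP[as' sb].
have sub : `[a, s]%classic `<=` (`[a, b]%classic : set R) by apply: subset_itvl; rewrite bnd_simp.
have ihs : mu.-integrable `[a, s] (EFin \o h) by apply: integrableS ih.
apply: (le_trans (le_normr_Rintegral _ ihs)) => //.
rewrite /Rintegral fine_le//.
- by apply: integrable_fin_num => //; exact: (integrable_abse ihs).
- by apply: integrable_fin_num => //; exact: (integrable_abse ih).
- apply: ge0_subset_integral => //.
  by have /integrable_abse/measurable_int := ih.
Qed.

Lemma sqint_primitive a b h : a <= b -> mu.-integrable `[a, b] (EFin \o h) ->
  sqint a b (fun s => \int[mu]_(t in `[a, s]) h t).
Proof.
move=> ab ih; apply: (@sqint_bounded _ _ _ _ (\int[mu]_(t in `[a, b]) `|h t|)).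
  apply: subspace_continuous_measurable_fun => //.
  exact: parameterized_integral_continuous.
exact: Rintegral_primitive_bounded.
Qed.

Lemma sqint_continuous a b phi : continuous phi -> sqint a b phi.
Proof.
move=> cphi; split; first by apply: measurable_funTS; exact: continuous_measurable_fun.
apply: continuous_compact_integrable; first exact: segment_compact.
apply: continuous_subspaceT => t.
rewrite (_ : (fun t0 => phi t0 ^+ 2) = (fun t0 => phi t0 * phi t0)); last exact/funext.
by apply: continuousM; exact: cphi.
Qed.

(** A smooth factor [phi] of size [E] with derivative of size [M * E] can be removed from
an integral, at the price of the square mean of the primitive of [h]. *)
Lemma sqr_Rintegral_parts a b h phi dphi M E : a < b -> sqint a b h ->
  (forall t : R, is_derive t 1 phi (dphi t)) -> continuous dphi ->
  `|phi b| <= E -> (forall t, t \in `[a, b] -> `|dphi t| <= M * E) ->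
  (\int[mu]_(t in `[a, b]) (h t * phi t)) ^+ 2 <=
  2 * E ^+ 2 * ((\int[mu]_(t in `[a, b]) h t) ^+ 2 +
    M ^+ 2 * ((b - a) * \int[mu]_(s in `[a, b]) (\int[mu]_(t in `[a, s]) h t) ^+ 2)).
Proof.
move=> ab sh dp cp phib phiM.
have ih := sqint_int sh.
have cphi : continuous phi.
  by move=> t; apply: differentiable_continuous; apply/derivable1_diffP; exact: ex_derive.
have sphi : sqint a b phi by exact: sqint_continuous.
have sF := sqint_primitive (ltW ab) ih.
have mdphi : measurable_fun (`[a, b]%classic : set R) dphi.
  by apply: measurable_funTS; exact: continuous_measurable_fun.
have sdF : sqint a b (fun s => dphi s * \int[mu]_(t in `[a, s]) h t).
  have := sqint_mul_bounded sF mdphi phiM.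
  by under [X in sqint _ _ X]funext do rewrite mulrC.
have -> : \int[mu]_(t in `[a, b]) (h t * phi t) = phi b * \int[mu]_(t in `[a, b]) h t -
   \int[mu]_(s in `[a, b]) (dphi s * \int[mu]_(t in `[a, s]) h t).
  rewrite -(integration_by_parts_primitive (ltW ab) ih dp cp).
  rewrite (_ : \int[mu]_(t in `[a, b]) (h t * (phi b - phi t)) =
    \int[mu]_(t in `[a, b]) (phi b * h t + (-1) * (h t * phi t))); last first.
    by apply: eq_Rintegral => t _; ring.
  rewrite RintegralDr; [|exact: integrable_mull|exact: sqint_mul].
  by rewrite RintegralZl//; ring.
have dF2 : (\int[mu]_(s in `[a, b]) (dphi s * \int[mu]_(t in `[a, s]) h t)) ^+ 2 <=
   (M * E) ^+ 2 * ((b - a) * \int[mu]_(s in `[a, b]) (\int[mu]_(t in `[a, s]) h t) ^+ 2).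
  apply: (le_trans (sqr_Rintegral_le ab sdF)).
  rewrite mulrCA ler_pM2l ?subr_gt0//.
  rewrite -RintegralZl//; last by case: sF.
  apply: le_Rintegral => //; first by case: sdF.
    by apply: integrable_mull; case: sF.
  move=> s sab; rewrite exprMn ler_wpM2r ?sqr_ge0//.
  rewrite -(real_normK (num_real (dphi s))) ler_sqr ?nnegrE ?phiM//.
  by rewrite (le_trans _ (phiM _ sab)).
have phib2 : phi b ^+ 2 <= E ^+ 2.
  by rewrite -(real_normK (num_real (phi b))) ler_sqr ?nnegrE//; apply: (le_trans _ phib).
move: dF2 phib2; move: (\int[mu]_(t in _) _) (phi b) (_ * \int[mu]_(t in _) _) (\int[mu]_(t in _) _).
move=> C p B A dF2 phib2.
apply: (@le_trans _ _ (2 * (p ^+ 2 * C ^+ 2) + 2 * A ^+ 2)).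
  by have := sqr_ge0 (p * C + A); lra.
have := ler_wpM2r (sqr_ge0 C) phib2.
by move: dF2; rewrite exprMn; lra.
Qed.

Lemma sum_Rintegral a b (f : nat -> R -> R) K :
  (forall k, mu.-integrable `[a, b] (EFin \o f k)) ->
  mu.-integrable `[a, b] (EFin \o (fun t => \sum_(k < K) f k t)) /\
  \sum_(k < K) \int[mu]_(t in `[a, b]) f k t = \int[mu]_(t in `[a, b]) \sum_(k < K) f k t.
Proof.
move=> fi; elim: K => [|K [iK IH]].
  split; last first.
    rewrite big_ord0 (_ : \int[mu]_(t in _) _ = \int[mu]_(t in `[a, b]) (cst 0 t)).
      by rewrite Rintegral_cst// mul0r.
    by apply: eq_Rintegral => t _; rewrite big_ord0.
  apply: (@integrable_bounded_itv _ _ _ _ 0).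
    by under [X in measurable_fun _ X]funext do rewrite big_ord0; exact: measurable_cst.
  by move=> t _; rewrite big_ord0 normr0.
have E : (fun t => \sum_(k < K.+1) f k t) = (fun t => \sum_(k < K) f k t + f K t).
  by apply/funext => t; rewrite big_ord_recr.
rewrite E; split; first exact: integrable_addr.
by rewrite big_ord_recr/= IH RintegralD.
Qed.

Lemma measurable_trig (D : set R) s c : measurable_fun D (fun t => trig s (c * t)).
Proof. by apply: measurable_comp_mull; exact: continuous_trig. Qed.

(** The majorant given by [sqr_Rintegral_parts] for the integral over [[a, b]] of [u] times
the trigonometric function of frequency [w * k]; it does not depend on the smooth factor. *)
Definition piece_coef M a b w u (s : bool) (k : nat) : R :=
  (\int[mu]_(t in `[a, b]) (u t * trig s (w * k%:R * t))) ^+ 2 +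
  M ^+ 2 * ((b - a) * \int[mu]_(r in `[a, b])
    (\int[mu]_(t in `[a, r]) (u t * trig s (w * k%:R * t))) ^+ 2).

Lemma sqint_trig a b u s c : sqint a b u -> sqint a b (fun t => u t * trig s (c * t)).
Proof.
move=> su; apply: (@sqint_mul_bounded _ _ _ _ _ 1) => //; first exact: measurable_trig.
by move=> t _; exact: trig_le1.
Qed.

(** Bessel's inequality applied to [u] and to the truncations of [u] to all [[a, r]]. *)
Lemma sum_piece_coef M a b w u s K : a < b -> w * (b - a) = pi *+ 2 -> sqint a b u ->
  \sum_(k < K) piece_coef M a b w u s k <=
  (b - a) * (1 + (M * (b - a)) ^+ 2) * \int[mu]_(t in `[a, b]) u t ^+ 2.
Proof.
move=> ab wab su.
set I := \int[mu]_(t in `[a, b]) u t ^+ 2.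
have L0 : 0 < b - a by rewrite subr_gt0.
pose e k t := trig s (w * k%:R * t).
have me k (D : set R) : measurable_fun D (e k) by exact: measurable_trig.
have be k t : `|e k t| <= 1 by exact: trig_le1.
have orth j k : (j < k)%N -> \int[mu]_(t in `[a, b]) (e j t * e k t) = 0.
  exact: trig_orthogonal.
have sue k : sqint a b (fun t => u t * e k t) by exact: sqint_trig.
have B1 := @bessel _ a b e u K ab (fun k => me k _) be orth su.
have iF k : mu.-integrable `[a, b] (EFin \o (fun r => (\int[mu]_(t in `[a, r]) (u t * e k t)) ^+ 2)).
  by have [] := sqint_primitive (ltW ab) (sqint_int (sue k)).
have [iS eS] := sum_Rintegral K iF.
have B2 : \sum_(k < K) \int[mu]_(r in `[a, b]) (\int[mu]_(t in `[a, r]) (u t * e k t)) ^+ 2 <=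
   (b - a) * ((b - a) * I).
  rewrite eS; apply: (@le_trans _ _ (\int[mu]_(r in `[a, b]) (cst ((b - a) * I) r))).
    apply: le_Rintegral => //.
      by apply: (@integrable_bounded_itv _ _ _ _ `|(b - a) * I|) => //.
    move=> r; rewrite /= in_itv/= => /andP[ar rb].
    have sub : `[a, b]%classic `&` `[a, r]%classic = (`[a, r]%classic : set R).
      by rewrite setIidr//; apply: subset_itvl; rewrite bnd_simp.
    have sur : sqint a b (u \_ `[a, r]).
      have [mu' iu] := su; split.
        by apply/measurable_restrict => //; rewrite sub; apply: measurable_funS mu' => //;
           rewrite -sub; exact: subIsetl.
      rewrite (_ : (EFin \o _) = (EFin \o (fun t => u t ^+ 2)) \_ `[a, r]); last first.
        by apply/funext => t; rewrite /= !patchE; case: ifP => // _; rewrite expr0n.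
      apply/integrable_restrict => //; rewrite sub; apply: integrableS iu => //.
      by rewrite -sub; exact: subIsetl.
    have := @bessel _ a b e _ K ab (fun k => me k _) be orth sur.
    rewrite [X in X <= _ -> _](_ : _ = \sum_(k < K) (\int[mu]_(t in `[a, r]) (u t * e k t)) ^+ 2); last first.
      apply: eq_bigr => k _; congr (_ ^+ 2); rewrite -sub Rintegral_mkcondr.
      by apply: eq_Rintegral => t _; rewrite !patchE sub; case: ifP => // _; rewrite mul0r.
    move/le_trans; apply; rewrite ler_pM2l//.
    apply: le_Rintegral => //; [by case: sur|by case: su|].
    by move=> t _; rewrite patchE; case: ifP => // _; rewrite expr0n sqr_ge0.
  by rewrite Rintegral_cst// /= lebesgue_measure_itv/= lte_fin ab/= mulrC.
rewrite /piece_coef big_split/= -mulr_sumr -mulr_sumr.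
have := ler_wpM2l (sqr_ge0 M) (ler_wpM2l (ltW L0) B2).
move: B1; rewrite /= -/I /e; move: (\sum_(_ < _) _) (\sum_(_ < _) _) => A B; rewrite exprMn.
clear; clearbody I; move: (b - a) => d; lra.
Qed.

End pieces.

(** * Summation over the pieces and over the frequencies *)

Section cells.
Context {R : realType}.
Notation mu := (@lebesgue_measure R).
Implicit Types (a b c t x y w M E : R) (f g h u phi dphi : R -> R).

Lemma sqrD_le (A B : R) : (A + B) ^+ 2 <= 2 * (A ^+ 2 + B ^+ 2).
Proof. by have := sqr_ge0 (A - B); lra. Qed.

Lemma sqrDs_le (s : bool) (A B : R) :
  (A + (if s then 1 else -1) * B) ^+ 2 <= 2 * (A ^+ 2 + B ^+ 2).
Proof.
by apply: (le_trans (sqrD_le _ _)); case: s; rewrite ?mul1r// mulN1r sqrrN.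
Qed.

(** Cauchy-Schwarz with the weights 2^-j, whose sum is at most 2. *)
Lemma sqr_sum_weighted J (X : nat -> R) :
  (\sum_(j < J) X j) ^+ 2 <= 2 * \sum_(j < J) 2 ^+ j * X j ^+ 2.
Proof.
elim: J X => [|J IH] X; first by rewrite !big_ord0 expr0n mulr0.
rewrite !big_ord_recl/= expr0 mul1r.
have -> : \sum_(i < J) 2 ^+ bump 0 i * X (bump 0 i) ^+ 2 =
    2 * \sum_(j < J) 2 ^+ j * X j.+1 ^+ 2.
  by rewrite mulr_sumr; apply: eq_bigr => j _; rewrite /bump/= add1n exprS mulrA.
have := IH (fun j => X j.+1).
rewrite [X in X ^+ 2 <= _ -> _](_ : _ = \sum_(i < J) X (bump 0 i)); last first.
  by apply: eq_bigr => j _; rewrite /bump/= add1n.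
move: (\sum_(i < J) _) (\sum_(i < J) _) (X _) => B A C AB.
by have := sqr_ge0 (C - A); lra.
Qed.

Lemma big_bool_swap (s : bool) (F : bool -> R) : \sum_(r : bool) F r = F s + F (~~ s).
Proof. by rewrite big_bool; case: s; rewrite // addrC. Qed.

(** The derivative of [trig s]. *)
Definition dtrig (s : bool) t : R := if s then cos t else - sin t.

Lemma is_derive_trig s t : is_derive t 1 (trig s) (dtrig s t).
Proof. by case: s; [exact: is_derive_sin|exact: is_derive_cos]. Qed.

Lemma dtrig_le1 s t : `|dtrig s t| <= 1.
Proof. by case: s; rewrite /dtrig ?normrN; [exact: cos_max|exact: sin_max]. Qed.

Lemma continuous_dtrig s : continuous (dtrig s).
Proof.
case: s; first exact: continuous_cos.
by move=> t; apply: (@continuousN R R R (@sin R)); exact: continuous_sin.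
Qed.

(** The addition formulas, written uniformly for the sine and the cosine. *)
Lemma trigD s x y : trig s (x + y) =
  trig s x * trig false y + (if s then 1 else -1) * (trig (~~ s) x * trig true y).
Proof. by case: s; rewrite /trig/= ?sinD ?cosD; ring. Qed.

(** The functions exp(- x t) cos(y t) and exp(- x t) sin(y t), the components of exp(- z t). *)
Definition damped x s y t : R := expR (- x * t) * trig s (y * t).

(** The derivative of [damped x s y]. *)
Definition ddamped x s y t : R :=
  expR (- x * t) * (y * dtrig s (y * t)) + trig s (y * t) * (- x * expR (- x * t)).

Lemma is_derive_damped x s y t : is_derive t 1 (damped x s y) (ddamped x s y t).
Proof.
exact: (@is_deriveM R R _ _ t 1 _ _
  (is_derive_comp_mull (- x) t (@is_derive_expR R))
  (is_derive_comp_mull y t (is_derive_trig s))).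
Qed.

Lemma continuous_damped x s y : continuous (damped x s y).
Proof.
by move=> t; apply: differentiable_continuous; apply/derivable1_diffP; apply: ex_derive; exact: is_derive_damped.
Qed.

Lemma continuous_ddamped x s y : continuous (ddamped x s y).
Proof.
have cE : continuous (fun t => expR (- x * t)) by apply: continuous_comp_mull; exact: continuous_expR.
have cT : continuous (fun t => trig s (y * t)) by apply: continuous_comp_mull; exact: continuous_trig.
have cD : continuous (fun t => dtrig s (y * t)) by apply: continuous_comp_mull; exact: continuous_dtrig.
move=> t; apply: (@continuousD R R R (fun t => expR (- x * t) * (y * dtrig s (y * t))) (fun t => trig s (y * t) * (- x * expR (- x * t)))).
  apply: (@continuousM R R (fun t => expR (- x * t)) (fun t => (y * dtrig s (y * t)))); first exact: cE.
  apply: (@continuousM R R (cst y)); [exact: cst_continuous|exact: cD].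
apply: (@continuousM R R (fun t => trig s (y * t)) (fun t => - x * expR (- x * t))); first exact: cT.
apply: (@continuousM R R (cst (- x))); [exact: cst_continuous|exact: cE].
Qed.

Lemma damped_le x s y t : `|damped x s y t| <= expR (- x * t).
Proof. by rewrite normrM ger0_norm ?expR_ge0// ler_piMr ?expR_ge0// trig_le1. Qed.

Lemma ddamped_le x s y t : 0 <= x -> 0 <= y ->
  `|ddamped x s y t| <= (x + y) * expR (- x * t).
Proof.
move=> x0 y0; apply: (le_trans (ler_normD _ _)).
rewrite !normrM normrN (ger0_norm (expR_ge0 _)) (ger0_norm x0) (ger0_norm y0) addrC mulrDl lerD//.
  by rewrite ler_piMl ?mulr_ge0 ?expR_ge0// trig_le1.
by rewrite mulrC ler_wpM2r ?expR_ge0// ler_piMr// dtrig_le1.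
Qed.

(** The damped cosine and sine integrals of [u] over [[a, b]]. *)
Definition damped_int x s y u a b := \int[mu]_(t in `[a, b]) (u t * damped x s y t).

Lemma measurable_damped (D : set R) x s y : measurable_fun D (damped x s y).
Proof. by apply: measurable_funTS; apply: continuous_measurable_fun; exact: continuous_damped. Qed.

Lemma sqint_damped a b x s y u : 0 <= x -> 0 <= a -> sqint a b u ->
  sqint a b (fun t => u t * damped x s y t).
Proof.
move=> x0 a0 su; apply: (@sqint_mul_bounded _ _ _ _ _ 1) => //; first exact: measurable_damped.
move=> t; rewrite in_itv/= => /andP[at' _]; apply: (le_trans (damped_le _ _ _ _)).
by rewrite -expR0 ler_expR mulNr oppr_le0 mulr_ge0// (le_trans a0).
Qed.

(** The frequency y is split as w k + eta: the smooth factor is the damped trigonometric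
function of frequency eta >= 0, which oscillates little on [[a, b]]. *)
Lemma sqr_damped_int_piece a b w u s k x y M E : a < b -> sqint a b u ->
  0 <= x -> 0 <= a -> w * k%:R <= y -> x + (y - w * k%:R) <= M -> expR (- x * a) <= E ->
  (damped_int x s y u a b) ^+ 2 <=
  4 * E ^+ 2 * (piece_coef M a b w u s k + piece_coef M a b w u (~~ s) k).
Proof.
move=> ab su x0 a0 wy xyM aE; set eta := y - w * k%:R in xyM.
have eta0 : 0 <= eta by rewrite subr_ge0.
have sut s' : sqint a b (fun t => u t * trig s' (w * k%:R * t)) by exact: sqint_trig.
have part s1 s2 : (\int[mu]_(t in `[a, b]) (u t * trig s1 (w * k%:R * t) * damped x s2 eta t)) ^+ 2
    <= 2 * E ^+ 2 * piece_coef M a b w u s1 k.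
  apply: (@sqr_Rintegral_parts _ a b (fun t => u t * trig s1 (w * k%:R * t)) (damped x s2 eta) (ddamped x s2 eta) M E ab (sut s1)).
  - exact: is_derive_damped.
  - exact: continuous_ddamped.
  - apply: (le_trans (damped_le _ _ _ _)); apply: le_trans aE.
    by rewrite ler_expR !mulNr lerN2 ler_wpM2l// ltW.
  - move=> t; rewrite in_itv/= => /andP[at' _].
    apply: (le_trans (ddamped_le _ _ _ _)) => //.
    apply: ler_pM => //; [by rewrite addr_ge0|].
    by apply: le_trans aE; rewrite ler_expR !mulNr lerN2 ler_wpM2l.
have -> : damped_int x s y u a b =
    \int[mu]_(t in `[a, b]) (u t * trig s (w * k%:R * t) * damped x false eta t) +
    (if s then 1 else -1) *
    \int[mu]_(t in `[a, b]) (u t * trig (~~ s) (w * k%:R * t) * damped x true eta t).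
  rewrite -RintegralDr; last 2 first.
    by apply: sqint_int; exact: sqint_damped.
    by apply: sqint_int; exact: sqint_damped.
  apply: eq_Rintegral => t _; rewrite /damped.
  have -> : y * t = w * k%:R * t + eta * t by rewrite -mulrDl /eta addrC subrK.
  rewrite trigD; move: (if s then _ else _) => e.
  move: (trig _ _) (trig _ _) (trig _ _) (trig _ _) => p1 p2 p3 p4; ring.
apply: (le_trans (sqrDs_le _ _ _)).
rewrite [leRHS](_ : _ = 2 * (2 * E ^+ 2 * piece_coef M a b w u s k +
   2 * E ^+ 2 * piece_coef M a b w u (~~ s) k)); last first.
  by move: (piece_coef _ _ _ _ _ _ _) (piece_coef _ _ _ _ _ _ _) => p q; ring.
by rewrite ler_pM2l// lerD.
Qed.

Lemma Rintegral_pieces (L : R) J g : 0 <= L ->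
  mu.-integrable `[0, J%:R * L] (EFin \o g) ->
  \int[mu]_(t in `[0, J%:R * L]) g t =
  \sum_(j < J) \int[mu]_(t in `[j%:R * L, j.+1%:R * L]) g t.
Proof.
move=> L0; elim: J => [|J IH] ig.
  by rewrite big_ord0 mul0r set_itv1 Rintegral_set1.
have JJ : J%:R * L <= J.+1%:R * L by rewrite ler_wpM2r// ler_nat.
have J0 : 0 <= J%:R * L by rewrite mulr_ge0.
have ig' : mu.-integrable `[0, J%:R * L] (EFin \o g).
  by apply: integrableS ig => //; apply: subset_itvl; rewrite bnd_simp.
rewrite big_ord_recr/= -IH// -(@Rintegral_itv_obnd_cbnd _ (J%:R * L)); last first.
  apply: integrableS ig => //; apply: subset_itv; rewrite bnd_simp//.
by rewrite -(@Rintegral_itvB _ _ _ _ (J%:R * L) ig) ?bnd_simp// addrC subrK.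
Qed.

(** A bound, valid for all z with 2 N k <= |Im z| <= 2 N (k + 1) and 0 <= Re z <= 2 N such that
exp(- z t) has modulus at most 2^-j on the j-th piece, of the squares of the damped integrals
of [u] over [[0, pi]]. The segment is cut into N pieces of length pi / N, on which the
trigonometric functions of frequencies 2 N k are orthogonal. *)
Definition cell_coef (N : nat) u (k : nat) : R :=
  8 * \sum_(j < N) 2 ^- j * \sum_(s : bool)
    piece_coef (4 * N%:R) (j%:R * (pi / N%:R)) (j.+1%:R * (pi / N%:R)) (2 * N%:R) u s k.

Lemma rescale_le (p C D : R) : 0 < p -> D <= 4 * p^-1 ^+ 2 * C -> p * D <= 4 * (p^-1 * C).
Proof.
move=> p0; rewrite -(ler_pM2l p0) => /le_trans; apply.
by rewrite le_eqVlt; apply/orP; left; apply/eqP; field; rewrite gt_eqF.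
Qed.

(** On the j-th piece the kernel has size at most 2^-j by the decay hypothesis, so that the
contributions of the pieces can be added. *)
Lemma sqr_damped_int_cell N u s k x y : (0 < N)%N -> sqint 0 pi u ->
  0 <= x <= 2 * N%:R -> (forall j, (j < N)%N -> expR (- x * (j%:R * (pi / N%:R))) <= 2 ^- j) ->
  2 * N%:R * k%:R <= y <= 2 * N%:R * k.+1%:R ->
  (damped_int x s y u 0 pi) ^+ 2 <= cell_coef N u k.
Proof.
move=> N0 su /andP[x0 xN] dec /andP[ky yk].
have NR : 0 < N%:R :> R by rewrite ltr0n.
set L : R := pi / N%:R in dec *.
have L0 : 0 < L by rewrite divr_gt0// pi_gt0.
have NL : N%:R * L = pi by rewrite /L mulrC divfK// gt_eqF.
have sj j : (j < N)%N -> sqint (j%:R * L) (j.+1%:R * L) u.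
  move=> jN; apply: sqintS su; first by rewrite mulr_ge0// ltW.
  by rewrite -NL ler_pM2r// ler_nat.
have ig : mu.-integrable `[0, N%:R * L] (EFin \o (fun t => u t * damped x s y t)).
  by apply: sqint_int; apply: sqint_damped => //; rewrite NL.
rewrite {1}/damped_int -NL (Rintegral_pieces (ltW L0) ig).
apply: (le_trans (sqr_sum_weighted N (fun j => damped_int x s y u (j%:R * L) (j.+1%:R * L)))).
rewrite /cell_coef -/L (_ : 8 = 2 * 4); last by ring.
rewrite -mulrA ler_pM2l// mulr_sumr ler_sum// => j _.
have jl : j%:R * L < j.+1%:R * L by rewrite ltr_pM2r// ltr_nat.
have := @sqr_damped_int_piece (j%:R * L) (j.+1%:R * L) (2 * N%:R) u s k x y (4 * N%:R) (2 ^- j)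
  jl (sj _ (ltn_ord j)) x0 (mulr_ge0 (ler0n _ _) (ltW L0)) ky _ (dec _ (ltn_ord j)).
rewrite (big_bool_swap s); cbv beta => H.
have /H {}H : x + (y - 2 * N%:R * k%:R) <= 4 * N%:R.
  by move: yk xN; rewrite -(natr1 k); clear; move: (N%:R) (k%:R) => n k'; lra.
by apply: (rescale_le _ H); rewrite exprn_gt0.
Qed.

Lemma piece_coef_ge0 M a b w u s k : a <= b -> 0 <= piece_coef M a b w u s k.
Proof.
move=> ab; rewrite addr_ge0 ?sqr_ge0// mulr_ge0 ?sqr_ge0// mulr_ge0 ?subr_ge0//.
by apply: Rintegral_ge0 => r _; exact: sqr_ge0.
Qed.

Lemma cell_coef_ge0 N u k : (0 < N)%N -> 0 <= cell_coef N u k.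
Proof.
move=> N0; rewrite mulr_ge0// sumr_ge0// => j _; rewrite mulr_ge0 ?invr_ge0 ?exprn_ge0//.
apply: sumr_ge0 => s _; apply: piece_coef_ge0; rewrite ler_wpM2r ?ler_nat//.
by rewrite divr_ge0// pi_ge0.
Qed.

Lemma sum_geometric_half J : \sum_(j < J) 2 ^- j <= 2 :> R.
Proof.
suff -> : \sum_(j < J) 2 ^- j = 2 - 2 * 2 ^- J :> R.
  by rewrite lerBlDr lerDl mulr_ge0// invr_ge0 exprn_ge0.
elim: J => [|J IH]; first by rewrite big_ord0 expr0 invr1 mulr1 subrr.
rewrite big_ord_recr/= IH exprS; have : 2 ^+ J != 0 :> R by rewrite expf_neq0.
by move: (2 ^+ J) => p p0; field.
Qed.

(** The bounds are summable over the cells; the sum is governed by the largest mass [q] of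
u^2 on a piece. *)
Lemma sum_cell_coef N u q K : (0 < N)%N -> sqint 0 pi u ->
  (forall j, (j < N)%N ->
    \int[mu]_(t in `[j%:R * (pi / N%:R), j.+1%:R * (pi / N%:R)]) u t ^+ 2 <= q) ->
  \sum_(k < K) cell_coef N u k <= 32 * (pi / N%:R) * (1 + (4 * pi) ^+ 2) * q.
Proof.
move=> N0 su uq.
have NR : 0 < N%:R :> R by rewrite ltr0n.
set L : R := pi / N%:R in uq *.
have L0 : 0 < L by rewrite divr_gt0// pi_gt0.
have NL : N%:R * L = pi by rewrite /L mulrC divfK// gt_eqF.
have q0 : 0 <= q.
  by apply: le_trans (uq 0%N N0); apply: Rintegral_ge0 => t _; exact: sqr_ge0.
rewrite /cell_coef -/L -mulr_sumr exchange_big/=.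
set C := L * (1 + (4 * pi) ^+ 2) * q.
have C0 : 0 <= C by rewrite mulr_ge0// mulr_ge0 ?addr_ge0 ?sqr_ge0// ltW.
apply: (@le_trans _ _ (8 * \sum_(j < N) 2 ^- j * (2 * C))).
  rewrite ler_pM2l// ler_sum// => j _; rewrite -mulr_sumr ler_pM2l ?invr_gt0 ?exprn_gt0//.
  rewrite exchange_big/= big_bool/= (_ : 2 * C = C + C); last by ring.
  have jl : j%:R * L < j.+1%:R * L by rewrite ltr_pM2r// ltr_nat.
  have dL : j.+1%:R * L - j%:R * L = L by rewrite -mulrBl -natrB// subSnn mul1r.
  have sju : sqint (j%:R * L) (j.+1%:R * L) u.
    apply: sqintS su; first by rewrite mulr_ge0// ltW.
    by rewrite -NL ler_pM2r// ler_nat ltn_ord.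
  have wL : 2 * N%:R * (j.+1%:R * L - j%:R * L) = pi *+ 2.
    by rewrite dL -mulrA NL mulr_natl.
  have le1 s : \sum_(i < K) piece_coef (4 * N%:R) (j%:R * L) (j.+1%:R * L) (2 * N%:R) u s i <= C.
    apply: (le_trans (sum_piece_coef _ _ _ jl wL sju)).
    have NL4 : 4 * N%:R * L = 4 * pi by rewrite -mulrA NL.
    rewrite dL NL4 /C ler_pM2l; first exact: uq.
    by rewrite mulr_gt0// ltr_pwDl// sqr_ge0.
  exact: lerD.
rewrite -mulr_suml [leRHS](_ : _ = 8 * (2 * (2 * C))); last by rewrite /C; ring.
by rewrite ler_pM2l//; apply: ler_wpM2r; [rewrite mulr_ge0|exact: sum_geometric_half].
Qed.

End cells.

(** * The Borel structure of the complex plane *)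

Section complex_borel.
Local Open Scope complex_scope.
Context {R : realType}.
Implicit Types (z w : R[i]).

Lemma cmodE z : `|z| = (cmod z)%:C.
Proof. exact: normc_def. Qed.

Lemma normr_Re_le z : `|complex.Re z| <= cmod z.
Proof. by rewrite -sqrtr_sqr /cmod ler_sqrt ?lerDl ?addr_ge0 ?sqr_ge0. Qed.

Lemma normr_Im_le z : `|complex.Im z| <= cmod z.
Proof. by rewrite -sqrtr_sqr /cmod ler_sqrt ?lerDr ?addr_ge0 ?sqr_ge0. Qed.

Lemma cmod_ge0 z : 0 <= cmod z. Proof. exact: sqrtr_ge0. Qed.

Lemma sqr_cmod z : cmod z ^+ 2 = complex.Re z ^+ 2 + complex.Im z ^+ 2.
Proof. by rewrite sqr_sqrtr// addr_ge0 ?sqr_ge0. Qed.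

Lemma cmod_le z : cmod z <= `|complex.Re z| + `|complex.Im z|.
Proof.
rewrite -ler_sqr ?nnegrE ?cmod_ge0 ?addr_ge0// sqr_cmod sqrrD !real_normK ?num_real//.
by rewrite addrAC lerDl mulrn_wge0// mulr_ge0.
Qed.

(** Open sets of the complex plane, described with the real-valued modulus. *)
Lemma open_cmodP (U : set R[i]^o) :
  open U <-> (forall z, U z -> exists2 e : R, 0 < e & forall w, cmod (z - w) < e -> U w).
Proof.
rewrite openE; split=> H z Uz.
  have /nbhs_ballP[e /= e0 eU] := H z Uz.
  have er : e = (complex.Re e)%:C.
    by move: e0; rewrite ltcE/= => /andP[/eqP e0 _]; case: (e) e0 => a b /= ->.
  exists (complex.Re e); first by move: e0; rewrite ltcE => /andP[].
  move=> w zw; apply: eU; rewrite -ball_normE /ball_/=.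
  by rewrite er cmodE ltcR.
have [e e0 eU] := H z Uz.
apply/nbhs_ballP; exists e%:C; first by rewrite /= ltcR.
by move=> w; rewrite -ball_normE /ball_/= cmodE ltcR; exact: eU.
Qed.

Lemma measurable_open (U : set R[i]^o) : open U -> measurable (U : set (Cborel R)).
Proof. by move=> oU; apply: sub_sigma_algebra. Qed.

Lemma measurable_continuous_Cborel (g : Cborel R -> R) :
  (forall z (e : R), 0 < e -> exists2 d : R, 0 < d &
     forall w, cmod (z - w) < d -> `|g z - g w| < e) ->
  measurable_fun setT g.
Proof.
move=> cg; apply: (measurability (@RGenOInfty.G R)); first exact: RGenOInfty.measurableE.
move=> _ [_ [a ->] <-]; rewrite setTI; apply: measurable_open; apply/open_cmodP => z /=.
rewrite in_itv/= andbT => az; have [|d d0 dg] := cg z (g z - a); first by rewrite subr_gt0.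
exists d => // w /dg; rewrite /= in_itv/= andbT ltr_norml => /andP[_].
by rewrite ltrD2l ltrN2.
Qed.

Lemma measurable_Re : measurable_fun setT (@complex.Re R : Cborel R -> R).
Proof.
apply: measurable_continuous_Cborel => z e e0; exists e => // w.
by apply: le_lt_trans; have := normr_Re_le (z - w); case: (z) (w) => ? ? [].
Qed.

Lemma measurable_Im : measurable_fun setT (@complex.Im R : Cborel R -> R).
Proof.
apply: measurable_continuous_Cborel => z e e0; exists e => // w.
by apply: le_lt_trans; have := normr_Im_le (z - w); case: (z) (w) => ? ? [].
Qed.

(** An open set of the plane is a countable union of rational squares, so measurability of
the two components is enough. *)
Lemma measurable_fun_complex d (T : measurableType d) (D : set T) (u v : T -> R) :
  measurable D -> measurable_fun D u -> measurable_fun D v ->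
  measurable_fun D (fun t => (u t +i* v t) : Cborel R).
Proof.
move=> mD mu mv; apply: (measurability (@open R[i]^o : set (set (Cborel R)))); first by [].
move=> _ [U oU <-].
(* A rational square is good when it lies in U. *)
pose good (p : rat * rat * rat) := `[< forall w, `|complex.Re w - ratr p.1.1| < ratr p.2 ->
  `|complex.Im w - ratr p.1.2| < ratr p.2 -> U w >].
pose box (p : rat * rat * rat) : set T := if good p then
  D `&` [set t | `|u t - ratr p.1.1| < ratr p.2 :> R] `&`
  (D `&` [set t | `|v t - ratr p.1.2| < ratr p.2 :> R]) else set0.
rewrite (_ : D `&` _ = \bigcup_p box p).
  apply: countable_bigcupT_measurable => //.
  move=> p; rewrite /box; case: ifP => // _; apply: measurableI.
    rewrite -[X in D `&` X]preimage_true.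
    by apply: measurable_fun_ltr => //; apply: measurableT_comp => //; exact: measurable_funB.
  rewrite -[X in D `&` X]preimage_true.
  by apply: measurable_fun_ltr => //; apply: measurableT_comp => //; exact: measurable_funB.
apply/seteqP; split => t /=; last first.
  move=> [p _]; rewrite /box; case: ifPn => // /asboolP gp [[Dt /= ut] [_ /= vt]].
  by split => //; exact: gp.
move=> [Dt Ut].
have /open_cmodP/(_ _ Ut)[e e0 eU] := oU.
have [r] := @rat_in_itvoo R 0 (e / 4) (divr_gt0 e0 (ltr0n _ 4)).
rewrite in_itv/= => /andP[r0 re].
have near x : exists q : rat, `|x - ratr q| < ratr r :> R.
  have [|q] := @rat_in_itvoo R x (x + ratr r); first by rewrite ltrDl.
  by rewrite in_itv/= => /andP[xq qx]; exists q; rewrite distrC gtr0_norm ?subr_gt0// ltrBlDl.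
have [p up] := near (u t); have [q vq] := near (v t).
exists (p, q, r) => //; rewrite /box ifT//.
apply/asboolP => w /= wp wq; apply: eU; apply: le_lt_trans (cmod_le _) _.
have -> : complex.Re ((u t +i* v t) - w) = u t - complex.Re w by case: (w).
have -> : complex.Im ((u t +i* v t) - w) = v t - complex.Im w by case: (w).
have aux (x1 x2 y1 y2 X Y rr ee : R) : x1 < rr -> x2 < rr -> y1 < rr -> y2 < rr ->
  rr < ee / 4 -> X <= x1 + y1 -> Y <= x2 + y2 -> X + Y < ee by lra.
apply: (aux _ _ _ _ _ _ _ _ up vq wp wq re).
  by rewrite (distrC (complex.Re w)); exact: ler_distD.
by rewrite (distrC (complex.Im w)); exact: ler_distD.
Qed.

End complex_borel.

(** * The Laplace transform through damped trigonometric integrals *)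

Section laplace_real.
Local Open Scope complex_scope.
Context {R : realType}.
Notation mu := (@lebesgue_measure R).
Implicit Types (x y t : R) (u v : R -> R) (s : bool).

Lemma trig_lipschitz s x y : `|trig s x - trig s y| <= `|x - y|.
Proof.
wlog xy : x y / x <= y.
  move=> H; have [/H//|/ltW/H] := leP x y.
  by rewrite distrC [leRHS]distrC.
rewrite distrC -(Rintegral_derive xy (is_derive_trig s) (continuous_dtrig (s:=s))).
have mD : measurable_fun (`[x, y]%classic : set R) (dtrig s).
  by apply: measurable_funTS; apply: continuous_measurable_fun; exact: continuous_dtrig.
have iD : mu.-integrable `[x, y] (EFin \o dtrig s).
  by apply: (@integrable_bounded_itv _ _ _ _ 1) => // t _; exact: dtrig_le1.
apply: (le_trans (le_normr_Rintegral _ iD)) => //.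
apply: (@le_trans _ _ (\int[mu]_(t in `[x, y]) (cst 1 t))).
  apply: le_Rintegral => //.
  - exact: (integrable_norm iD).
  - by apply: (@integrable_bounded_itv _ _ _ _ 1) => // t _; rewrite normr1.
  - by move=> t _; exact: dtrig_le1.
rewrite Rintegral_cst// mul1r /= lebesgue_measure_itv/= lte_fin.
by case: ifPn => _ /=; rewrite ?normr_ge0// distrC ler_norm.
Qed.

Lemma expR_lipschitz (a b m : R) : a <= m -> b <= m -> `|expR a - expR b| <= expR m * `|a - b|.
Proof.
wlog ba : a b / b <= a.
  move=> H am bm; have [/H->//|/ltW/H] := leP b a.
  by rewrite distrC (distrC a); apply.
move=> am bm; rewrite !ger0_norm ?subr_ge0 ?ler_expR//.
apply: (@le_trans _ _ (expR a * (a - b))); last first.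
  by rewrite ler_wpM2r ?subr_ge0// ler_expR.
have -> : expR a - expR b = expR a * (1 - expR (b - a)).
  by rewrite mulrBr mulr1 -expRD (addrC a) subrK.
by rewrite ler_pM2l ?expR_gt0// lerBlDr -lerBlDl; have := expR_ge1Dx (b - a); lra.
Qed.

(** No sign condition on [x] is needed, as the segment is bounded. *)
Lemma integrable_damped a b x s y u : sqint a b u ->
  mu.-integrable `[a, b] (EFin \o (fun t => u t * damped x s y t)).
Proof. by move=> su; apply: sqint_mul => //; apply: sqint_continuous; exact: continuous_damped. Qed.

Lemma damped_lipschitz s x y x' y' t : 0 <= t <= pi -> `|x - x'| <= 1 ->
  `|damped x s y t - damped x' s y' t| <=
  expR (pi * (`|x| + 1)) * pi * (`|x - x'| + `|y - y'|).
Proof.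
move=> /andP[t0 tpi] xx'; set m := pi * (`|x| + 1).
have bnd z : `|z| <= `|x| + 1 -> - z * t <= m.
  move=> zx; apply: (le_trans (ler_norm _)); rewrite normrM normrN (ger0_norm t0) mulrC.
  by rewrite /m ler_pM.
have xm : - x * t <= m by rewrite bnd// lerDl.
have xm' : - x' * t <= m.
  rewrite bnd// -lerBlDl; apply: le_trans xx'.
  by rewrite distrC; exact: lerB_dist.
rewrite /damped.
have -> : expR (- x * t) * trig s (y * t) - expR (- x' * t) * trig s (y' * t) =
  (expR (- x * t) - expR (- x' * t)) * trig s (y * t) +
  expR (- x' * t) * (trig s (y * t) - trig s (y' * t)) by ring.
apply: (le_trans (ler_normD _ _)); rewrite !normrM mulrDr; apply: lerD.
  apply: (@le_trans _ _ `|expR (- x * t) - expR (- x' * t)|).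
    by rewrite ler_piMr// trig_le1.
  apply: (le_trans (expR_lipschitz xm xm')); rewrite -mulrA ler_pM2l ?expR_gt0//.
  have -> : - x * t - - x' * t = - (t * (x - x')) by ring.
  by rewrite normrN normrM (ger0_norm t0) ler_wpM2r.
rewrite (ger0_norm (expR_ge0 _)) -mulrA; apply: ler_pM; rewrite ?expR_ge0 ?ler_expR//.
apply: (le_trans (trig_lipschitz _ _ _)).
by rewrite -mulrBl normrM (ger0_norm t0) mulrC ler_wpM2r.
Qed.

(** Continuity of the damped integrals in (x, y) = (Re z, Im z). *)
Lemma damped_int_continuous s u (z : R[i]) (e : R) : sqint 0 pi u -> 0 < e ->
  exists2 d : R, 0 < d & forall w : R[i], cmod (z - w) < d ->
  `|damped_int (complex.Re z) s (complex.Im z) u 0 pi -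
    damped_int (complex.Re w) s (complex.Im w) u 0 pi| < e.
Proof.
move=> su e0; case: z => x y /=.
have iu := sqint_int su.
set A := \int[mu]_(t in `[0, pi]) `|u t|.
have A0 : 0 <= A by exact: Rintegral_ge0.
set K := expR (pi * (`|x| + 1)) * pi.
have K0 : 0 <= K by rewrite mulr_ge0 ?expR_ge0// pi_ge0.
have KA : 0 < 2 * K * A + 1 by rewrite ltr_wpDl// mulr_ge0// mulr_ge0.
exists (Num.min 1 (e / (2 * K * A + 1))); first by rewrite lt_min ltr01 divr_gt0.
move=> [x' y']; set c := cmod _; rewrite lt_min => /andP[c1 ce].
have xx' : `|x - x'| <= c by exact: (normr_Re_le ((x +i* y) - (x' +i* y'))).
have yy' : `|y - y'| <= c by exact: (normr_Im_le ((x +i* y) - (x' +i* y'))).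
rewrite /damped_int/= -RintegralB//; [|exact: integrable_damped|exact: integrable_damped].
apply: (@le_lt_trans _ _ (\int[mu]_(t in `[0, pi]) (K * (2 * c) * `|u t|))).
  have iB : mu.-integrable `[0, pi] (EFin \o (fun t => u t * damped x s y t - u t * damped x' s y' t)).
    have := integrable_addr (integrable_damped x s y su) (integrable_mull (-1) (integrable_damped x' s y' su)).
    by under [X in _.-integrable _ (_ \o X)]funext do rewrite mulN1r.
  apply: (le_trans (le_normr_Rintegral _ iB)) => //.
  apply: le_Rintegral => //; first exact: (integrable_norm iB).
    by apply: integrable_mull; exact: (integrable_norm iu).
  move=> t /=; rewrite in_itv/= => tpi.
  rewrite -mulrBr normrM mulrC ler_wpM2r//.
  apply: (le_trans (damped_lipschitz _ _ _ tpi (le_trans xx' (ltW c1)))).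
  by rewrite -/K ler_wpM2l// mulr2n mulrDl mul1r lerD.
rewrite RintegralZl//; last exact: (integrable_norm iu).
rewrite -/A.
move: ce; rewrite ltr_pdivlMr//; apply: le_lt_trans.
have -> : K * (2 * c) * A = c * (2 * K * A) by ring.
by rewrite ler_wpM2l ?cmod_ge0// lerDl.
Qed.

Lemma measurable_damped_int s u : sqint 0 pi u ->
  measurable_fun setT (fun z : Cborel R =>
    damped_int (complex.Re (z : R[i])) s (complex.Im (z : R[i])) u 0 pi).
Proof.
move=> su; apply: measurable_continuous_Cborel => z e e0.
exact: damped_int_continuous.
Qed.

Lemma Rintegral_unit_supported (D : set R) (g : R -> R) :
  (`]0, 1[%classic : set R) `<=` D -> (forall t, t \notin `]0, 1[ -> g t = 0) ->
  \int[mu]_(t in D) g t = \int[mu]_(t in `]0, 1[) g t.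
Proof.
move=> sD g0; rewrite Rintegral_mkcond [RHS]Rintegral_mkcond.
apply: eq_Rintegral => t _; rewrite !patchE.
case: ifPn => [tD|]; case: ifPn => //.
- by rewrite notin_setE/= => /negP/g0.
- by rewrite inE => /sD/mem_set ->.
Qed.

(** The interval [[0, pi]] contains the support of the extended function; its length pi is
the one on which the frequencies 2 k are orthogonal. *)
Lemma Laplace_damped (f : R -> R[i]) (u := fun t => complex.Re (extend0 f t))
    (v := fun t => complex.Im (extend0 f t)) (x y : R) :
  sqint 0 pi u -> sqint 0 pi v ->
  Laplace (extend0 f) (x +i* y) =
  (damped_int x false y u 0 pi + damped_int x true y v 0 pi) +i*
  (damped_int x false y v 0 pi - damped_int x true y u 0 pi).
Proof.
move=> su sv; rewrite /Laplace /Cintegral.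
have u0 t : t \notin `]0, 1[ -> u t = 0 by rewrite /u /extend0 => /negbTE ->.
have v0 t : t \notin `]0, 1[ -> v t = 0 by rewrite /v /extend0 => /negbTE ->.
have sub1 : (`]0, 1[%classic : set R) `<=` `]0, +oo[%classic.
  by move=> t /=; rewrite !in_itv/= => /andP[-> _].
have sub2 : (`]0, 1[%classic : set R) `<=` `[0, pi]%classic.
  move=> t /=; rewrite !in_itv/= => /andP[/ltW -> t1]/=.
  by rewrite (le_trans (ltW t1))// (le_trans _ (pi_ge2 R))// ler1n.
have kern t : cexp (- ((x +i* y) * t%:C)) * extend0 f t =
    (u t * damped x false y t + v t * damped x true y t) +i*
    (v t * damped x false y t - u t * damped x true y t).
  rewrite /u /v; case: (extend0 f t) => a b; rewrite /cexp /damped /trig /=.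
  rewrite !mulr0 subr0 add0r cosN sinN -mulNr.
  by apply/eqP; rewrite eq_complex /=; apply/andP; split; apply/eqP; ring.
congr (_ +i* _).
- rewrite (Rintegral_unit_supported sub1)//; last first.
    by move=> t t01; rewrite kern/= u0// v0// !mul0r addr0.
  rewrite /damped_int -RintegralD//; [|exact: integrable_damped|exact: integrable_damped].
  rewrite -(Rintegral_unit_supported sub2)//; last first.
    by move=> t t01; rewrite kern/= u0// v0// !mul0r addr0.
  by apply: eq_Rintegral => t _; rewrite kern.
- rewrite (Rintegral_unit_supported sub1)//; last first.
    by move=> t t01; rewrite kern/= u0// v0// !mul0r subr0.
  rewrite /damped_int -RintegralB//; [|exact: integrable_damped|exact: integrable_damped].
  rewrite -(Rintegral_unit_supported sub2)//; last first.
    by move=> t t01; rewrite kern/= u0// v0// !mul0r subr0.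
  by apply: eq_Rintegral => t _; rewrite kern.
Qed.

Lemma measurable_Laplace (f : R -> R[i]) :
  sqint 0 pi (fun t => complex.Re (extend0 f t)) ->
  sqint 0 pi (fun t => complex.Im (extend0 f t)) ->
  measurable_fun setT (Laplace (extend0 f) : Cborel R -> Cborel R).
Proof.
move=> su sv.
rewrite (_ : (Laplace (extend0 f) : Cborel R -> Cborel R) = fun z : Cborel R => 
  (damped_int (complex.Re (z : R[i])) false (complex.Im (z : R[i])) (fun t => complex.Re (extend0 f t)) 0 pi +
   damped_int (complex.Re (z : R[i])) true (complex.Im (z : R[i])) (fun t => complex.Im (extend0 f t)) 0 pi) +i*
  (damped_int (complex.Re (z : R[i])) false (complex.Im (z : R[i])) (fun t => complex.Im (extend0 f t)) 0 pi -
   damped_int (complex.Re (z : R[i])) true (complex.Im (z : R[i])) (fun t => complex.Re (extend0 f t)) 0 pi)).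
  apply: measurable_fun_complex => //.
  - by apply: measurable_funD; exact: measurable_damped_int.
  - by apply: measurable_funB; exact: measurable_damped_int.
by apply/funext => -[x y]; exact: Laplace_damped.
Qed.

Lemma measurable_fun_cmod d (T : measurableType d) (D : set T) (F : T -> Cborel R) :
  measurable_fun D F -> measurable_fun D (fun z => cmod (F z)).
Proof.
move=> mF; apply: (@measurableT_comp _ _ _ _ _ _ (@Num.sqrt R)).
  by apply: continuous_measurable_fun; exact: sqrt_continuous.
by apply: measurable_funD; apply: measurable_funX;
  [apply: measurableT_comp mF; exact: measurable_Re|apply: measurableT_comp mF; exact: measurable_Im].
Qed.

End laplace_real.

(** * The Young function *)

Section young_function.
Local Open Scope complex_scope.
Context {R : realType}.
Implicit Types (r U lam k : R) (n : nat).
Variable alpha : R.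
Hypothesis alpha1 : 1 < alpha.

Let alpha0 : 0 < alpha. Proof. exact: lt_trans alpha1. Qed.

Lemma Phi_ge0 r : 0 <= Phi alpha r.
Proof. by rewrite /Phi; have := expR_ge1Dx (r `^ alpha); lra. Qed.

Lemma Phi0 : Phi alpha 0 = 0.
Proof. by rewrite /Phi powR0 ?gt_eqF// expR0; ring. Qed.

Lemma measurable_Phi : measurable_fun setT (Phi alpha).
Proof.
apply: measurable_funB => //; apply: measurable_funB; last exact: measurable_powR.
by apply: measurableT_comp; [exact: measurable_expR|exact: measurable_powR].
Qed.

(** Convexity of the exponential between 0 and U, from its tangent at lam * U. *)
Lemma expR_chord lam U : 0 <= lam <= 1 -> expR (lam * U) <= 1 - lam + lam * expR U.
Proof.
move=> /andP[l0 l1]; set c := lam * U.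
have e0 := expR_gt0 c.
have e1 : expR c * (1 + (1 - lam) * U) <= expR U.
  have -> : expR U = expR c * expR ((1 - lam) * U).
    by rewrite -expRD; congr expR; rewrite /c; ring.
  by rewrite ler_pM2l//; exact: expR_ge1Dx.
have e2 : expR c * (1 - c) <= 1.
  have E : expR c * expR (- c) = 1 by rewrite -expRD subrr expR0.
  by rewrite -[leRHS]E ler_pM2l//; exact: expR_ge1Dx.
have := lerD (ler_wpM2l l0 e1) (ler_wpM2l (_ : 0 <= 1 - lam) e2).
rewrite subr_ge0 => /(_ l1) {e0 e1 e2}; rewrite -/c.
move: (expR c) (expR U) => E F; rewrite /c; clear; lra.
Qed.

Lemma Phi_scale lam r : 0 <= lam <= 1 -> 0 <= r ->
  Phi alpha (lam `^ alpha^-1 * r) <= lam * Phi alpha r.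
Proof.
move=> l01 r0; have /andP[l0 l1] := l01.
rewrite /Phi powRM ?powR_ge0// -powRrM mulVf ?gt_eqF// powRr1//.
by have := expR_chord (r `^ alpha) l01; move: (r `^ alpha) => U; lra.
Qed.

Lemma expR_ge_sqr (x : R) : 0 <= x -> x ^+ 2 <= 4 * expR x.
Proof.
move=> x0; have -> : expR x = expR (x / 2) ^+ 2 by rewrite expr2 -expRD -splitr.
have h := expR_ge1Dx (x / 2).
rewrite -[4](_ : 2 ^+ 2 = _); last by ring.
by rewrite -exprMn ler_sqr ?nnegrE ?mulr_ge0 ?expR_ge0//; lra.
Qed.

Lemma expR_le_Phi r : 0 <= r -> expR (r `^ alpha) <= 2 * (Phi alpha r + 1).
Proof.
move=> r0; rewrite /Phi; move: (r `^ alpha) (powR_ge0 r alpha) => U U0.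
suff : 2 * U <= expR U by lra.
have -> : expR U = expR (U / 2) ^+ 2 by rewrite expr2 -expRD -splitr.
have h := expR_ge1Dx (U / 2).
have : (1 + U / 2) ^+ 2 <= expR (U / 2) ^+ 2.
  by rewrite ler_sqr ?nnegrE ?expR_ge0//; lra.
by have := sqr_ge0 (1 - U / 2); lra.
Qed.

Lemma expR1_le4 : expR 1 <= 4 :> R.
Proof.
have -> : expR 1 = (expR (- 2^-1) ^+ 2)^-1 :> R.
  by rewrite expr2 -expRD -expRN; congr expR; field.
rewrite -[4]invrK lef_pV2 ?posrE ?invr_gt0// ?exprn_gt0 ?expR_gt0//.
have -> : 4^-1 = 2^-1 ^+ 2 :> R by rewrite expr2 -invfM -natrM.
rewrite ler_sqr ?nnegrE ?expR_ge0 ?invr_ge0//.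
by have := expR_ge1Dx (- 2^-1 : R); lra.
Qed.

(** The inequality behind the weights n^(2/alpha): either r^alpha <= n, or
r^2 <= n^(2/alpha) (r^alpha / n)^2 and the square is absorbed by exp(r^alpha - n). *)
Lemma sqr_le_Phi n r : (0 < n)%N -> 0 <= r ->
  r ^+ 2 <= n%:R `^ (2 / alpha) * (1 + 32 * expR (- n%:R) * (Phi alpha r + 1)).
Proof.
move=> n0 r0; have nR : 0 < n%:R :> R by rewrite ltr0n.
set U := r `^ alpha.
have U0 : 0 <= U by exact: powR_ge0.
have -> : r ^+ 2 = U `^ (2 / alpha).
  rewrite /U -powRrM mulrCA divff ?gt_eqF// mulr1 -[2 in RHS]/(2%:R) powR_mulrn//.
have n0' : 0 < n%:R `^ (2 / alpha) :> R by exact: powR_gt0.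
have [Un|nU] := leP U n%:R.
  apply: (@le_trans _ _ (n%:R `^ (2 / alpha))).
    by rewrite ge0_ler_powR ?nnegrE ?divr_ge0// ltW.
  apply: ler_peMr; first exact: ltW.
  by rewrite lerDl !mulr_ge0 ?expR_ge0// addr_ge0 ?Phi_ge0.
(* From here on r^alpha > n, so v > 1. *)
set v := U / n%:R.
have v1 : 1 <= v by rewrite ler_pdivlMr// mul1r ltW.
have v0 : 0 <= v by rewrite (le_trans _ v1).
have -> : U = n%:R * v by rewrite /v mulrC divfK// gt_eqF.
rewrite powRM ?ler0n// ler_pM2l//.
apply: (@le_trans _ _ (v ^+ 2)).
  rewrite -powR_mulrn// ler_powR// ler_pdivrMr// ler_peMr// ltW//.
apply: (le_trans (expR_ge_sqr v0)).
have ev : expR v <= 4 * (expR (- n%:R) * expR U).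
  rewrite -expRD.
  apply: (@le_trans _ _ (expR 1 * expR (v - 1))).
    by rewrite -expRD addrC subrK.
  apply: ler_pM; rewrite ?expR_ge0//.
  - exact: expR1_le4.
  - rewrite ler_expR (_ : - n%:R + U = n%:R * (v - 1)).
      by rewrite ler_peMl ?subr_ge0// ler1n.
    by rewrite mulrBr mulr1 /v mulrC divfK ?gt_eqF// addrC.
have eU := ler_wpM2l (expR_ge0 (- n%:R)) (expR_le_Phi r0).
apply: (@le_trans _ _ (4 * (4 * (expR (- n%:R) * (2 * (Phi alpha r + 1)))))).
  by rewrite ler_pM2l//; apply: (le_trans ev); rewrite ler_pM2l.
by move: (expR _) (Phi _ _) => A B; lra.
Qed.

End young_function.

(** * Functions of the Orlicz space *)

Section orlicz.
Local Open Scope complex_scope.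
Context {R : realType}.
Notation mu := (@lebesgue_measure R).
Implicit Types (r k : R) (n : nat) (f : R -> Cborel R).
Variable alpha : R.
Hypothesis alpha1 : 1 < alpha.

Let alpha0 : 0 < alpha. Proof. exact: lt_trans alpha1. Qed.

(** The numbers [k] whose infimum is the Orlicz norm of [f]. *)
Definition unit_modular f k :=
  0 < k /\ (\int[mu]_(s in `]0%R, 1%R[) (Phi alpha (k^-1 * cmod (f s)))%:E <= 1)%E.

Lemma measurable_Phi_cmod f k : measurable_fun (`]0, 1[ : set R) f ->
  measurable_fun (`]0, 1[ : set R) (fun s => Phi alpha (k^-1 * cmod (f s))).
Proof.
move=> mf; apply: (@measurableT_comp _ _ _ _ _ _ (Phi alpha)); first exact: measurable_Phi.
by apply: measurable_funM => //; exact: measurable_fun_cmod.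
Qed.

(** The infimum defining the Orlicz norm is taken over a nonempty set: by convexity a
large multiple of any admissible [k] has modular at most 1. *)
Lemma Orlicz_modular f : Orlicz (Phi alpha) f -> exists k, unit_modular f k.
Proof.
move=> [mf [k0 k00 ik]].
have mP k := measurable_Phi_cmod k mf.
set I := (\int[mu]_(s in `]0%R, 1%R[) (Phi alpha (k0^-1 * cmod (f s)))%:E)%E.
have I0 : (0 <= I)%E by apply: integral_ge0 => s _; rewrite lee_fin Phi_ge0.
have Ifin : I \is a fin_num by exact: integrable_fin_num.
have A0 : 0 <= fine I by exact: fine_ge0.
have A1 : 0 < 1 + fine I by rewrite ltr_pwDl.
(* By convexity, this factor brings the modular down to at most 1. *)
set lam := (1 + fine I)^-1.
have l0 : 0 < lam by rewrite invr_gt0.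
have l1 : lam <= 1 by rewrite invf_le1// lerDl.
have la0 : 0 < lam `^ alpha^-1 by exact: powR_gt0.
exists (k0 / lam `^ alpha^-1); split; first by rewrite divr_gt0.
apply: (@le_trans _ _ (\int[mu]_(s in `]0%R, 1%R[) (lam%:E * (Phi alpha (k0^-1 * cmod (f s)))%:E))%E).
  apply: ge0_le_integral => //.
  - by move=> s _; rewrite lee_fin Phi_ge0.
  - by apply/measurable_EFinP; exact: mP.
  - by apply: measurable_funeM; apply/measurable_EFinP; exact: mP.
  - move=> s _; rewrite -EFinM lee_fin invfM invrK -mulrA mulrCA mulrA -mulrA.
    by apply: Phi_scale => //; rewrite ?(ltW l0)// mulr_ge0 ?invr_ge0 ?cmod_ge0// ltW.
rewrite ge0_integralZl//; last 3 first.
- by apply/measurable_EFinP; exact: mP.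
- by move=> s _; rewrite lee_fin Phi_ge0.
- by rewrite lee_fin ltW.
rewrite -/I -(fineK Ifin) -EFinM lee_fin mulrC ler_pdivrMr// mul1r.
by rewrite lerDr.
Qed.

Section component.
Local Open Scope complex_scope.
Variables (f : R -> Cborel R) (k : R).
Hypothesis mf : measurable_fun (`]0, 1[ : set R) f.
Hypothesis fk : unit_modular f k.
Variable p : R[i] -> R.
Hypothesis p0 : p 0 = 0.
Hypothesis mp : measurable_fun setT (p : Cborel R -> R).
Hypothesis p_le : forall z, `|p z| <= cmod z.

Let u (t : R) := p (extend0 f t).
Let W := (fun s => Phi alpha (k^-1 * cmod (f s))) \_ (`]0, 1[ : set R).

Let k0 : 0 < k. Proof. by case: fk. Qed.

Let mu_u : measurable_fun setT u.
Proof.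
rewrite (_ : u = (p \o f) \_ (`]0, 1[ : set R)).
  apply/(measurable_restrictT (p \o f)) => //.
  exact: (measurableT_comp mp mf).
by apply/funext => t; rewrite /u /extend0 patchE mem_setE; case: ifP.
Qed.

Let W_ge0 t : 0 <= W t.
Proof. by rewrite /W patchE; case: ifP => // _; exact: Phi_ge0. Qed.

Let mW : measurable_fun setT W.
Proof.
apply/(measurable_restrictT (fun s => Phi alpha (k^-1 * cmod (f s)))) => //.
exact: measurable_Phi_cmod.
Qed.

Let intW a b : (\int[mu]_(t in `[a, b]) (W t)%:E <= 1)%E.
Proof.
apply: (@le_trans _ _ (\int[mu]_t (W t)%:E)%E).
  apply: ge0_subset_integral => //; first exact/measurable_EFinP.
  by move=> t _; rewrite lee_fin.
case: fk => _; apply: le_trans.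
rewrite [leRHS]integral_mkcond le_eqVlt; apply/orP; left; apply/eqP; apply: eq_integral => t _.
by rewrite /W !patchE; case: ifP.
Qed.

Let iW a b : mu.-integrable `[a, b] (EFin \o W).
Proof.
apply/integrableP; split; first by apply/measurable_EFinP; apply: measurable_funTS.
apply: (@le_lt_trans _ _ 1%E); last exact: ltry.
apply: le_trans (intW a b); rewrite le_eqVlt; apply/orP; left; apply/eqP.
by apply: eq_integral => t _ /=; rewrite ger0_norm.
Qed.

Let u_le n t : (0 < n)%N ->
  u t ^+ 2 <= k ^+ 2 * n%:R `^ (2 / alpha) * (1 + 32 * expR (- n%:R) * (W t + 1)).
Proof.
move=> n0; rewrite /u /extend0 /W patchE mem_setE.
have C0 : 0 <= k ^+ 2 * n%:R `^ (2 / alpha) by rewrite mulr_ge0 ?sqr_ge0 ?powR_ge0.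
case: ifP => _; last first.
  by rewrite p0 expr0n mulr_ge0// addr_ge0// !mulr_ge0 ?expR_ge0// add0r.
have r0 : 0 <= k^-1 * cmod (f t) by rewrite mulr_ge0 ?cmod_ge0// invr_ge0 ltW.
apply: (@le_trans _ _ (k ^+ 2 * (k^-1 * cmod (f t)) ^+ 2)).
  rewrite -exprMn mulrA divff ?gt_eqF// mul1r -(real_normK (num_real (p _))).
  by rewrite ler_sqr ?nnegrE ?cmod_ge0.
by rewrite -mulrA ler_pM2l ?exprn_gt0//; exact: sqr_le_Phi.
Qed.

Lemma sqint_component : sqint 0 pi u.
Proof.
split; first exact: measurable_funTS.
apply: (@integrable_le_itv _ _ _ _ (fun t => k ^+ 2 * 1%:R `^ (2 / alpha) * (1 + 32 * expR (- 1%:R) * (W t + 1)))).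
- by apply: measurable_funX; exact: measurable_funTS.
- apply: integrable_mull; apply: integrable_addr.
    by apply: (@integrable_bounded_itv _ _ _ _ 1) => // t _; rewrite normr1.
  apply: integrable_mull; apply: integrable_addr => //.
  by apply: (@integrable_bounded_itv _ _ _ _ 1) => // t _; rewrite normr1.
- by move=> t _; rewrite ger0_norm ?sqr_ge0//; exact: u_le.
Qed.

(** The mass of a component of [f] on an interval of length pi / N is at most of order
n^(2/alpha) / N, where exp(- n) <= 1 / N. *)
Lemma component_piece n (N : nat) a b : (0 < n)%N -> (0 < N)%N -> expR (- n%:R) <= N%:R^-1 :> R ->
  0 <= a -> b <= pi -> b - a = pi / N%:R ->
  \int[mu]_(t in `[a, b]) u t ^+ 2 <= k ^+ 2 * n%:R `^ (2 / alpha) * (164 / N%:R).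
Proof.
move=> n0 N0 nN a0 bpi ba.
have NR : 0 < N%:R :> R by rewrite ltr0n.
have ab : a < b by rewrite -subr_gt0 ba divr_gt0// pi_gt0.
have pi4 : pi <= 4 :> R by have := pihalf_lt2 R; lra.
have i1 : mu.-integrable `[a, b] (EFin \o cst (1 : R)).
  by apply: (@integrable_bounded_itv _ _ _ _ 1) => // t _; rewrite normr1.
set C := k ^+ 2 * n%:R `^ (2 / alpha).
have C0 : 0 <= C by rewrite mulr_ge0 ?sqr_ge0 ?powR_ge0.
have E1 : \int[mu]_(t in `[a, b]) (cst 1 t) = pi / N%:R.
  by rewrite Rintegral_cst// mul1r /= lebesgue_measure_itv/= lte_fin ab/=.
have iW1 : mu.-integrable `[a, b] (EFin \o (fun t => cst 1 t + 1 * W t)).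
  by apply: integrable_addr => //; exact: integrable_mull.
apply: (@le_trans _ _ (\int[mu]_(t in `[a, b]) (C * (cst 1 t + 32 * expR (- n%:R) * (cst 1 t + 1 * W t))))).
  apply: le_Rintegral => //.
  - by have [] := sqintS a0 bpi sqint_component.
  - by apply: integrable_mull; apply: integrable_addr => //; exact: integrable_mull.
  - by move=> t _; rewrite mul1r (addrC _ (W t)); exact: u_le.
rewrite RintegralZl//; last by apply: integrable_addr => //; exact: integrable_mull.
rewrite RintegralDr// RintegralDr// E1 mul1r ler_wpM2l//.
have W1 : \int[mu]_(t in `[a, b]) W t <= 1.
  have := fine_le _ _ (intW a b); rewrite -[fine 1]/1; apply => //.
  exact: integrable_fin_num.
have N1 : N%:R^-1 <= 1 :> R by rewrite invf_le1// ler1n.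
have Ni : 0 < N%:R^-1 :> R by rewrite invr_gt0.
have W0 : 0 <= \int[mu]_(t in `[a, b]) W t by exact: Rintegral_ge0.
move: W0 W1 Ni N1 nN (expR_ge0 (- n%:R : R)) pi4 (pi_ge0 R); clear.
move: (N%:R^-1) (\int[mu]_(t in _) _) (expR _) (@pi R) => x w e P w0 w1 x0 x1 ex e0 P4 P0.
have h1 : P * x <= 4 * x by rewrite ler_pM2r.
have h2 : P * x <= 4 by apply: (le_trans h1); lra.
have h3 : e * (P * x + w) <= x * 5.
  have Px0 : 0 <= P * x + w by rewrite addr_ge0// mulr_ge0// ltW.
  by apply: ler_pM => //; lra.
by lra.
Qed.

End component.
End orlicz.

(** * Boxes, levels and cells of the half-plane *)

Section boxes.
Local Open Scope complex_scope.
Context {R : realType}.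
Implicit Types (x y : R) (I : set R) (z : Cborel R).

Lemma measurable_preimage_Re (A : set R) : measurable A ->
  measurable ([set z | A (complex.Re (z : R[i]))] : set (Cborel R)).
Proof. by move=> mA; have := @measurable_Re R measurableT _ mA; rewrite setTI. Qed.

Lemma measurable_preimage_Im (A : set R) : measurable A ->
  measurable ([set z | A (complex.Im (z : R[i]))] : set (Cborel R)).
Proof. by move=> mA; have := @measurable_Im R measurableT _ mA; rewrite setTI. Qed.

Lemma measurable_Cplus : measurable (@Cplus R).
Proof.
have := @measurable_preimage_Re `]0, +oo[%classic (measurable_itv _).
congr measurable; apply/seteqP; split=> z /=; rewrite in_itv/= andbT//.
Qed.

Lemma measurable_strip (n : int) : measurable (@strip R n).
Proof.
have := @measurable_preimage_Re `[(2 : R) ^ n, 2 ^ (n + 1)[%classic (measurable_itv _).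
by congr measurable; apply/seteqP; split=> z /=; rewrite in_itv/=.
Qed.

Lemma measurable_Qbox I : is_interval I -> measurable (Qbox I).
Proof.
move=> /is_interval_measurable mI.
have mR := @measurable_preimage_Re `]0, ilength I]%classic (measurable_itv _).
have := measurableI _ _ (measurable_preimage_Im mI) mR.
by congr measurable; apply/seteqP; split=> z /=; rewrite in_itv/=.
Qed.

Lemma ilength_ge0 I : 0 <= ilength I.
Proof. by rewrite fine_ge0. Qed.

Lemma ilength_gt0 I : bounded_interval I -> 0 < ilength I.
Proof. by move=> [_ /andP[l0 loo]]; rewrite fine_gt0// l0 loo. Qed.

Lemma bounded_interval_itv (i : interval R) (a b : R) : a < b ->
  lebesgue_measure ([set` i] : set R) = (b - a)%:E -> is_interval ([set` i] : set R) ->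
  bounded_interval [set` i] /\ ilength [set` i] = b - a.
Proof.
move=> ab il ii; split; last by rewrite /ilength il.
by split => //; rewrite il lte_fin subr_gt0 ab ltry.
Qed.

(** An interval has diameter at most its length. *)
Lemma interval_dist I : bounded_interval I -> forall x y, I x -> I y -> y - x <= ilength I.
Proof.
move=> bI x y Ix Iy; have [yx|xy] := leP y x.
  by rewrite (@le_trans _ _ 0)// ?ilength_ge0// subr_le0.
case: bI => iI /andP[_ loo].
rewrite -lee_fin fineK ?ge0_fin_numE//.
have -> : (y - x)%:E = lebesgue_measure (`[x, y]%classic : set R).
  by rewrite lebesgue_measure_itv/= lte_fin xy EFinB.
apply: le_measure; rewrite ?inE//; first exact: is_interval_measurable.
by move=> t /=; rewrite in_itv/=; exact: iI.
Qed.

Lemma carleson_le (nu : set (Cborel R) -> \bar R) I : bounded_interval I ->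
  (nu (Qbox I) <= carleson 2 nu * (ilength I ^+ 2)%:E)%E.
Proof.
move=> bI; have l0 := ilength_gt0 bI.
have : (nu (Qbox I) * ((ilength I `^ 2)^-1)%:E <= carleson 2 nu)%E.
  by apply: ereal_sup_ubound; exists I.
rewrite (powR_mulrn 2 (ltW l0)) lee_pdivrMr// exprn_gt0//.
Qed.

Lemma carleson_ge0 (nu : set (Cborel R) -> \bar R) : (forall A, 0 <= nu A)%E ->
  (0 <= carleson 2 nu)%E.
Proof.
move=> nu0; have [bI lI] : bounded_interval (`[0, 1]%classic : set R) /\ ilength (`[0, 1]%classic : set R) = 1 - 0.
  apply: bounded_interval_itv => //; last exact: interval_is_interval.
  by rewrite lebesgue_measure_itv/= lte_fin ltr01 EFinB.
have /le_trans : (0 <= nu (Qbox `[0%R, 1%R]) * ((ilength (`[0, 1]%classic : set R) `^ 2)^-1)%:E)%E.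
  by rewrite mule_ge0// lee_fin invr_ge0 powR_ge0.
by apply; apply: ereal_sup_ubound; exists `[0, 1]%classic.
Qed.

(** The strip 2^n <= Re z < 2^(n+1) for n >= 1, and 0 < Re z < 2 for n = 0; the levels
partition the half-plane. *)
Definition level (n : nat) : set (Cborel R) :=
  [set z | (if n is 0 then 0 < complex.Re (z : R[i]) else 2 ^+ n <= complex.Re (z : R[i]))
    && (complex.Re (z : R[i]) < 2 ^+ n.+1)].

(** The part of a level where |Im z| lies in [[2 N k, 2 N (k + 1)[[, with N = 2^n: two boxes of
side comparable to 2^n, symmetric with respect to the real axis. *)
Definition cell (n k : nat) : set (Cborel R) := level n `&`
  [set z | 2 * (2 ^ n)%:R * k%:R <= `|complex.Im (z : R[i])| < 2 * (2 ^ n)%:R * k.+1%:R].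

Lemma measurable_level n : measurable (level n).
Proof.
case: n => [|n].
  have := @measurable_preimage_Re `]0, 2 ^+ 1[%classic (measurable_itv _).
  by congr measurable; apply/seteqP; split=> z /=; rewrite in_itv/=.
have := @measurable_preimage_Re `[2 ^+ n.+1, 2 ^+ n.+2[%classic (measurable_itv _).
by congr measurable; apply/seteqP; split=> z /=; rewrite in_itv/=.
Qed.

Lemma measurable_cell n k : measurable (cell n k).
Proof.
apply: measurableI; first exact: measurable_level.
have mA : measurable [set y : R | 2 * (2 ^ n)%:R * k%:R <= `|y| < 2 * (2 ^ n)%:R * k.+1%:R].
  have := @normr_measurable R setT measurableT _ (measurable_itv `[2 * (2 ^ n)%:R * k%:R, 2 * (2 ^ n)%:R * k.+1%:R[).
  by rewrite setTI; congr measurable; apply/seteqP; split=> y /=; rewrite in_itv/=.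
exact: (measurable_preimage_Im mA).
Qed.

Lemma Cplus_level : @Cplus R = \bigcup_n level n.
Proof.
apply/seteqP; split => [z z0|z [n _]]; last first.
  rewrite /level/= /Cplus/=; case: n => [|n] /andP[//+ _].
  by apply: lt_le_trans; rewrite exprn_gt0.
have {}z0 : 0 < complex.Re (z : R[i]) by [].
set x := complex.Re (z : R[i]) in z0.
have [x2|x2] := ltP x 2; first by exists 0%N => //; rewrite /level/= -/x z0 expr1.
have tr := truncn_itv (ltW z0).
have t0 : (0 < Num.truncn x)%N by rewrite truncn_gt0 (le_trans _ x2)// ler1n.
exists (trunc_log 2 (Num.truncn x)) => //.
have lo := @trunc_logP 2 _ (isT : (1 < 2)%N) t0.
have hi := @trunc_log_ltn 2 (Num.truncn x) isT.
have /andP[tr1 tr2] := tr.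
have : x < 2 ^+ (trunc_log 2 (Num.truncn x)).+1.
  by apply: (lt_le_trans tr2); rewrite -natrX ler_nat.
have : 2 ^+ trunc_log 2 (Num.truncn x) <= x.
  by apply: le_trans tr1; rewrite -natrX ler_nat.
rewrite /level/= -/x; by case: (trunc_log _ _) => [|n] h1 h2; rewrite h2 ?z0 ?h1.
Qed.

Lemma trivIset_level : trivIset setT level.
Proof.
apply: ltn_trivIset => m n mn; apply/seteqP; split=> z//= -[].
rewrite /level/= => /andP[_ zn] /andP[mz _].
have : complex.Re (z : R[i]) < complex.Re (z : R[i]).
  apply: (lt_le_trans zn); case: m mn mz => // m mn mz.
  by apply: le_trans mz; rewrite ler_eXn2l// ltr1n.
by rewrite ltxx.
Qed.

Lemma level_cell n : level n = \bigcup_k cell n k.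
Proof.
apply/seteqP; split => [z nz|z [k _] []//].
have N0 : 0 < 2 * (2 ^ n)%:R :> R by rewrite mulr_gt0// ltr0n expn_gt0.
set y : R := `|complex.Im (z : R[i])|.
have y0 : 0 <= y / (2 * (2 ^ n)%:R) by exact: (divr_ge0 (normr_ge0 _) (ltW N0)).
exists (Num.truncn (y / (2 * (2 ^ n)%:R))) => //; split => //=.
have := truncn_itv y0; rewrite ler_pdivlMr// ltr_pdivrMr//.
by rewrite [in X in X -> _]mulrC [in X in _ && X -> _]mulrC.
Qed.

Lemma trivIset_cell n : trivIset setT (cell n).
Proof.
have N0 : 0 < 2 * (2 ^ n)%:R :> R by rewrite mulr_gt0// ltr0n expn_gt0.
apply: ltn_trivIset => k l kl; apply/seteqP; split=> z//= -[[_ /= /andP[_ zk]] [_ /= /andP[lz _]]].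
have : `|complex.Im (z : R[i])| < `|complex.Im (z : R[i])|.
  by apply: (lt_le_trans zk); apply: le_trans lz; rewrite ler_pM2l// ler_nat.
by rewrite ltxx.
Qed.

End boxes.

(** * Measures of cells and integrals over a level *)

Section level_integrals.
Local Open Scope complex_scope.
Context {R : realType}.
Variable nu : {measure set (Cborel R) -> \bar R}.
Implicit Types (n k : nat).

Lemma strip_level n : (0 < n)%N -> @strip R n%:Z = level n.
Proof.
by case: n => // n _; apply/seteqP; split=> z; rewrite /strip/level/= -exprnP -[(_ ^ (_ + 1))]/(_ ^+ _) addn1.
Qed.

(** A cell is covered by two Carleson boxes of side 2^(n+1). *)
Lemma cell_cover n k : exists I J : set R,
  [/\ bounded_interval I, ilength I = 2 * (2 ^ n)%:R,
      bounded_interval J, ilength J = 2 * (2 ^ n)%:R &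
      (nu (cell n k) <= nu (Qbox I `&` level n) + nu (Qbox J `&` level n))%E].
Proof.
set N : R := 2 * (2 ^ n)%:R.
have N0 : 0 < N by rewrite mulr_gt0// ltr0n expn_gt0.
have kk : N * k%:R < N * k.+1%:R by rewrite ltr_pM2l// ltr_nat.
have lN : N * k.+1%:R - N * k%:R = N by rewrite -mulrBr -natrB// subSnn mulr1.
have [bI lI] : bounded_interval (`[N * k%:R, N * k.+1%:R[%classic : set R) /\
    ilength (`[N * k%:R, N * k.+1%:R[%classic : set R) = N * k.+1%:R - N * k%:R.
  apply: bounded_interval_itv => //; last exact: interval_is_interval.
  by rewrite lebesgue_measure_itv/= lte_fin kk EFinB.
have kk' : - (N * k.+1%:R) < - (N * k%:R) by rewrite ltrN2.
have [bJ lJ] : bounded_interval (`]- (N * k.+1%:R), - (N * k%:R)]%classic : set R) /\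
    ilength (`]- (N * k.+1%:R), - (N * k%:R)]%classic : set R) = - (N * k%:R) - - (N * k.+1%:R).
  apply: bounded_interval_itv => //; last exact: interval_is_interval.
  by rewrite lebesgue_measure_itv/= lte_fin kk' EFinB.
rewrite lN in lI; rewrite opprK addrC lN in lJ.
exists `[N * k%:R, N * k.+1%:R[%classic, `]- (N * k.+1%:R), - (N * k%:R)]%classic; split => //.
have mI := measurableI _ _ (measurable_Qbox (proj1 bI)) (measurable_level n).
have mJ := measurableI _ _ (measurable_Qbox (proj1 bJ)) (measurable_level n).
have := measureU2 nu mI mJ; apply: le_trans; apply: le_measure; rewrite ?inE//.
- exact: measurable_cell.
- exact: measurableU.
move=> z [zn /=]; rewrite -/N => zk.
have z0 : 0 < complex.Re (z : R[i]).
  have : @Cplus R z by rewrite Cplus_level; exists n.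
  by [].
have zN : complex.Re (z : R[i]) <= N.
  have /andP[_ /ltW] := zn.
  by rewrite /N natrX -exprS.
have [y0|y0] := leP 0 (complex.Im (z : R[i])); [left|right]; split => //; split; rewrite ?lI ?lJ ?z0//=.
  by rewrite in_itv/=; move: zk; rewrite ger0_norm.
by rewrite in_itv/= lerNr ltrNl; move: zk; rewrite ltr0_norm// => /andP[-> ->].
Qed.

Lemma nu_cell_strip n k : (0 < n)%N ->
  (nu (cell n k) <= carleson 2 (strip_part nu n%:Z) * (8 * (2 ^ n)%:R ^+ 2)%:E)%E.
Proof.
move=> n0; have [I [J [bI lI bJ lJ le]]] := cell_cover n k.
apply: (le_trans le); rewrite -strip_level//.
have := carleson_le (strip_part nu n%:Z) bI; have := carleson_le (strip_part nu n%:Z) bJ.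
rewrite lI lJ => h1 h2; apply: (le_trans (leeD h2 h1)).
rewrite -ge0_muleDr ?lee_fin ?sqr_ge0// -EFinD; set X := (X in (X <= _)%E); set Y := (X in (_ <= X)%E).
suff -> : X = Y by []. rewrite /X /Y; congr (_ * _%:E)%E; ring.
Qed.

(** The supremum over the boxes of side 2 is taken over a nonempty set. *)
Lemma base_sup_ge0 : (0 <= ereal_sup [set nu (Qbox I) |
  I in [set I | bounded_interval I /\ ilength I = 2%R]])%E.
Proof.
have [bI lI] : bounded_interval (`[0, 2]%classic : set R) /\ ilength (`[0, 2]%classic : set R) = 2 - 0.
  apply: bounded_interval_itv => //; last exact: interval_is_interval.
  by rewrite lebesgue_measure_itv/= lte_fin ltr0n/= EFinB.
rewrite subr0 in lI.
have /le_trans : (0 <= nu (Qbox `[0%R, 2%R]))%E by exact: measure_ge0.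
by apply; apply: ereal_sup_ubound; exists `[0, 2]%classic.
Qed.

Lemma nu_cell_base k :
  (nu (cell 0 k) <= 2%:E * ereal_sup [set nu (Qbox I) |
       I in [set I | bounded_interval I /\ ilength I = 2%R]])%E.
Proof.
have [I [J [bI lI bJ lJ le]]] := cell_cover 0 k.
rewrite expn0 mulr1 in lI lJ.
apply: (le_trans le); set s := ereal_sup _.
have mI (K : set R) : bounded_interval K -> (nu (Qbox K `&` level 0) <= nu (Qbox K))%E.
  move=> [iK _]; apply: le_measure; rewrite ?inE//; last exact: measurable_Qbox.
  by apply: measurableI; [exact: measurable_Qbox|exact: measurable_level].
rewrite mule_natl mule2n; apply: leeD.
  by apply: (le_trans (mI _ bI)); apply: ereal_sup_ubound; exists I.
by apply: (le_trans (mI _ bJ)); apply: ereal_sup_ubound; exists J.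
Qed.

Lemma integral_level_le n (h : Cborel R -> R) (G : nat -> R) (M B : R) :
  measurable_fun setT h -> (forall z, 0 <= h z) -> (forall k, 0 <= G k) ->
  (forall k z, cell n k z -> h z <= G k) ->
  (forall k, (nu (cell n k) <= M%:E)%E) ->
  (forall K, \sum_(k < K) G k <= B) ->
  (\int[nu]_(z in level n) (h z)%:E <= (M * B)%:E)%E.
Proof.
move=> mh h0 G0 hG nuM GB.
have M0 : 0 <= M by rewrite -lee_fin; apply: le_trans (nuM 0%N).
rewrite level_cell ge0_integral_bigcup//=; last 4 first.
- by move=> k; exact: measurable_cell.
- by apply/measurable_EFinP; exact: measurable_funTS.
- by move=> z _; rewrite lee_fin.
- exact: trivIset_cell.
have ck k : (\int[nu]_(z in cell n k) (h z)%:E <= (M * G k)%:E)%E.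
  apply: (@le_trans _ _ (\int[nu]_(z in cell n k) (cst (G k)%:E z))%E).
    apply: ge0_le_integral => //.
    - exact: measurable_cell.
    - by move=> z _; rewrite lee_fin.
    - by apply/measurable_EFinP; exact: measurable_funTS.
    - by move=> z zk; rewrite lee_fin hG.
  rewrite integral_cst; last exact: measurable_cell.
  by rewrite mulrC EFinM lee_wpmul2l// lee_fin.
apply: lime_le.
  by apply: is_cvg_nneseries => k _ _; apply: integral_ge0 => z _; rewrite lee_fin.
apply: nearW => K; apply: (@le_trans _ _ (\sum_(0 <= k < K) (M * G k)%:E)%E).
  by apply: lee_sum => k _; exact: ck.
by rewrite sumEFin lee_fin -mulr_sumr ler_wpM2l// big_mkord.
Qed.

End level_integrals.

(** * The upper bound *)

Section upper.
Local Open Scope complex_scope.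
Context {R : realType}.
Notation mu := (@lebesgue_measure R).
Implicit Types (n k : nat) (x y t : R) (u : R -> R).
Variable alpha : R.
Hypothesis alpha1 : 1 < alpha.

(** The squares of the damped integrals are even in [y]. *)
Lemma sqr_damped_int_abs x s y u a b : sqint a b u ->
  (damped_int x s y u a b) ^+ 2 = (damped_int x s `|y| u a b) ^+ 2.
Proof.
move=> su; have [y0|y0] := leP 0 y; first by rewrite ger0_norm.
rewrite (ltr0_norm y0) /damped_int; case: s; last first.
  by congr (_ ^+ 2); apply: eq_Rintegral => t _; rewrite /damped /trig (mulNr y) cosN.
rewrite (_ : \int[mu]_(t in `[a, b]) (u t * damped x true (- y) t) =
  \int[mu]_(t in `[a, b]) ((-1) * (u t * damped x true y t))).
  by rewrite RintegralZl ?mulN1r ?sqrrN//; exact: integrable_damped.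
by apply: eq_Rintegral => t _; rewrite /damped /trig (mulNr y) sinN; ring.
Qed.

(** The decay of the kernel from one piece to the next; on the level 0 there is only one
piece and nothing to prove. *)
Lemma level_decay n x j : (if n is 0 then true else 2 ^+ n <= x) -> (j < 2 ^ n)%N ->
  expR (- x * (j%:R * (pi / (2 ^ n)%:R))) <= 2 ^- j.
Proof.
case: n => [_|n nx _].
  by rewrite expn0 ltnS leqn0 => /eqP ->; rewrite mul0r mulr0 expR0 expr0 invr1.
have N0 : 0 < (2 ^ n.+1)%:R :> R by rewrite ltr0n expn_gt0.
apply: (@le_trans _ _ (expR (- (j%:R * pi)))).
  rewrite ler_expR mulNr lerN2 mulrCA ler_wpM2l//.
  by rewrite mulrCA ler_peMr ?pi_ge0// ler_pdivlMr// mul1r natrX.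
rewrite expRN lef_pV2 ?posrE ?exprn_gt0 ?expR_gt0// expRM_natl.
rewrite lerXn2r ?nnegrE ?expR_ge0//.
by apply: le_trans (expR_ge1Dx _); have := pi_ge2 R; lra.
Qed.

Lemma expRN_le_pow n : expR (- n%:R) <= (2 ^ n)%:R^-1 :> R.
Proof.
rewrite expRN lef_pV2 ?posrE ?expR_gt0 ?ltr0n ?expn_gt0//.
rewrite -[n%:R]mulr1 expRM_natl natrX lerXn2r ?nnegrE ?expR_ge0//.
by apply: le_trans (expR_ge1Dx _); lra.
Qed.

Let u_ (f : R -> R[i]) t := complex.Re (extend0 f t).
Let v_ (f : R -> R[i]) t := complex.Im (extend0 f t).

Lemma sqr_cmod_Laplace_cell (f : R -> R[i]) n k (z : Cborel R) :
  sqint 0 pi (u_ f) -> sqint 0 pi (v_ f) -> cell n k z ->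
  cmod (Laplace (extend0 f) z) ^+ 2 <=
  4 * (cell_coef (2 ^ n) (u_ f) k + cell_coef (2 ^ n) (v_ f) k).
Proof.
move=> su sv; case: z => x y [zn /= zk].
have N0 : (0 < 2 ^ n)%N by rewrite expn_gt0.
have x0 : 0 < x.
  have : @Cplus R (x +i* y) by rewrite Cplus_level; exists n.
  by [].
have xN : 0 <= x <= 2 * (2 ^ n)%:R.
  by rewrite (ltW x0)/=; have /andP[_ /ltW] := zn; rewrite natrX -exprS.
have dec j : (j < 2 ^ n)%N -> expR (- x * (j%:R * (pi / (2 ^ n)%:R))) <= 2 ^- j.
  by apply: level_decay; case: (n) zn => // m /andP[].
have yk : 2 * (2 ^ n)%:R * k%:R <= `|y| <= 2 * (2 ^ n)%:R * k.+1%:R.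
  by have /andP[-> /ltW ->] := zk.
rewrite (Laplace_damped x y su sv) sqr_cmod/=.
have U s := sqr_damped_int_cell s N0 su xN dec yk.
have V s := sqr_damped_int_cell s N0 sv xN dec yk.
have {}U s : damped_int x s y (u_ f) 0 pi ^+ 2 <= cell_coef (2 ^ n) (u_ f) k.
  by rewrite sqr_damped_int_abs.
have {}V s : damped_int x s y (v_ f) 0 pi ^+ 2 <= cell_coef (2 ^ n) (v_ f) k.
  by rewrite sqr_damped_int_abs.
have := lerD (sqrD_le (damped_int x false y (u_ f) 0 pi) (damped_int x true y (v_ f) 0 pi))
  (sqrD_le (damped_int x false y (v_ f) 0 pi) (- damped_int x true y (u_ f) 0 pi)).
move/le_trans; apply; rewrite sqrrN.
have := lerD (lerD (U false) (U true)) (lerD (V false) (V true)).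
move: (cell_coef _ _ _) (cell_coef _ _ _) => A B.
move: (_ ^+ 2) (_ ^+ 2) (_ ^+ 2) (_ ^+ 2) => C D E F.
by clear; lra.
Qed.

(** The factors 8 come from the measure of a cell and from the two components of the
function and of its transform, the others from [sum_cell_coef] and [component_piece]. *)
Definition upper_const : R := 8 * (8 * (32 * pi * (1 + (4 * pi) ^+ 2) * 164)).

Lemma upper_const_gt0 : 0 < upper_const.
Proof.
have P0 := pi_gt0 R; have Q0 : 0 < 1 + (4 * pi) ^+ 2 :> R by rewrite ltr_pwDl// sqr_ge0.
have h n : 0 < n.+1%:R :> R := ltr0Sn R n.
exact: (mulr_gt0 (h 7) (mulr_gt0 (h 7) (mulr_gt0 (mulr_gt0 (mulr_gt0 (h 31) P0) Q0) (h 163)))).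
Qed.

Variable nu : {measure set (Cborel R) -> \bar R}.

(** The integral of |L f|^2 over one level. The factor N^2 of the measure of a cell
cancels the factor pi / N of [sum_cell_coef] and the factor 1 / N of [component_piece]. *)
Lemma integral_level_Laplace (f : R -> Cborel R) (k : R) n (M : R) :
  measurable_fun (`]0, 1[ : set R) f -> unit_modular alpha f k ->
  (forall l, (nu (cell n l) <= (8 * (2 ^ n)%:R ^+ 2 * M)%:E)%E) ->
  (\int[nu]_(z in level n) (cmod (Laplace (extend0 f) z) ^+ 2)%:E <=
    (upper_const * k ^+ 2 * ((maxn n 1)%:R `^ (2 / alpha) * M))%:E)%E.
Proof.
move=> mf fk nuM.
set N := (2 ^ n)%N in nuM *.
have N0 : (0 < N)%N by rewrite expn_gt0.
have NR : 0 < N%:R :> R by rewrite ltr0n.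
set m := maxn n 1.
have m0 : (0 < m)%N by rewrite leq_max orbT.
have mN : expR (- m%:R) <= N%:R^-1 :> R.
  apply: le_trans (expRN_le_pow n); rewrite ler_expR lerN2 ler_nat leq_maxl//.
have su : sqint 0 pi (u_ f).
  exact: (sqint_component alpha1 mf fk (erefl _) measurable_Re normr_Re_le).
have sv : sqint 0 pi (v_ f).
  exact: (sqint_component alpha1 mf fk (erefl _) measurable_Im normr_Im_le).
set q := k ^+ 2 * m%:R `^ (2 / alpha) * (164 / N%:R).
have pieces j : (j < N)%N -> [/\ 0 <= j%:R * (pi / N%:R) :> R, j.+1%:R * (pi / N%:R) <= pi :> R &
   j.+1%:R * (pi / N%:R) - j%:R * (pi / N%:R) = pi / N%:R :> R].
  move=> jN; have p0 : 0 < pi / N%:R :> R by rewrite divr_gt0// pi_gt0.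
  split; first by rewrite mulr_ge0// ltW.
    by rewrite mulrCA ler_piMr ?pi_ge0// ler_pdivrMr// mul1r ler_nat.
  by rewrite -mulrBl -natrB// subSnn mul1r.
have uq j : (j < N)%N ->
    \int[mu]_(t in `[j%:R * (pi / N%:R), j.+1%:R * (pi / N%:R)]) u_ f t ^+ 2 <= q.
  move=> /pieces[a0 bpi ba].
  exact: (component_piece alpha1 mf fk (erefl _) measurable_Re normr_Re_le m0 N0 mN a0 bpi ba).
have vq j : (j < N)%N ->
    \int[mu]_(t in `[j%:R * (pi / N%:R), j.+1%:R * (pi / N%:R)]) v_ f t ^+ 2 <= q.
  move=> /pieces[a0 bpi ba].
  exact: (component_piece alpha1 mf fk (erefl _) measurable_Im normr_Im_le m0 N0 mN a0 bpi ba).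
set S := 32 * (pi / N%:R) * (1 + (4 * pi) ^+ 2) * q.
have SU K : \sum_(l < K) cell_coef N (u_ f) l <= S by exact: sum_cell_coef.
have SV K : \sum_(l < K) cell_coef N (v_ f) l <= S by exact: sum_cell_coef.
have -> : upper_const * k ^+ 2 * (m%:R `^ (2 / alpha) * M) = 8 * N%:R ^+ 2 * M * (8 * S).
  rewrite /S /q /upper_const; move: (_ `^ _) (@pi R) => A P.
  by field; rewrite gt_eqF.
apply: (@integral_level_le _ nu n _ (fun l => 4 * (cell_coef N (u_ f) l + cell_coef N (v_ f) l))).
- by apply: measurable_funX; apply: measurable_fun_cmod; exact: measurable_Laplace.
- by move=> z; exact: sqr_ge0.
- by move=> l; rewrite mulr_ge0// addr_ge0// cell_coef_ge0.
- by move=> l z; exact: sqr_cmod_Laplace_cell.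
- exact: nuM.
- move=> K; rewrite -mulr_sumr big_split/= (_ : 8 * S = 4 * (S + S)); last by ring.
  by rewrite ler_pM2l//; apply: lerD; [exact: SU|exact: SV].
Qed.

End upper.

Section upper_bound.
Local Open Scope complex_scope.
Context {R : realType}.
Variable alpha : R.
Hypothesis alpha1 : 1 < alpha.
Variable nu : {measure set (Cborel R) -> \bar R}.

Lemma sqre_poweR (x : \bar R) : (0 <= x)%E -> (x ^+ 2 = x `^ 2)%E.
Proof.
case: x => [r| |]// r0; last by rewrite expe2 mulyy poweRyr// pnatr_eq0.
by rewrite -EFin_expe poweR_EFin powR_mulrn.
Qed.

Lemma L2norm_sqr (F : Cborel R -> Cborel R) :
  (L2norm nu F ^+ 2 = \int[nu]_z (cmod (F z) ^+ 2)%:E)%E.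
Proof.
rewrite sqre_poweR ?Lnorm_ge0// poweR_Lnorm//; apply: eq_integral => z _.
by rewrite poweR_EFin ger0_norm ?cmod_ge0// powR_mulrn ?cmod_ge0.
Qed.

Lemma lee_sqr_EFin (x : \bar R) (a : R) : (0 <= x)%E -> 0 <= a ->
  (x ^+ 2 <= (a ^+ 2)%:E)%E = (x <= a%:E)%E.
Proof.
case: x => [r| |]// r0 a0.
by rewrite -EFin_expe !lee_fin ler_sqr.
Qed.

Lemma carleson_testing_ge0 : (0 <= carleson_testing alpha nu)%E.
Proof.
apply: adde_ge0.
  apply: nneseries_ge0 => n _ _; rewrite mule_ge0 ?lee_fin ?powR_ge0//.
  by apply: carleson_ge0 => A; exact: measure_ge0.
exact: base_sup_ge0.
Qed.

Hypothesis nuC : carried_by_Cplus nu.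

Lemma integral_Cplus (h : Cborel R -> R) : measurable_fun setT h -> (forall z, 0 <= h z) ->
  (\int[nu]_z (h z)%:E = \int[nu]_(z in @Cplus R) (h z)%:E)%E.
Proof.
move=> mh h0; rewrite -(setUv (@Cplus R)) ge0_integral_setU//=; last 5 first.
- exact: measurable_Cplus.
- by apply: measurableC; exact: measurable_Cplus.
- by apply/measurable_EFinP; exact: measurable_funTS.
- by move=> z _; rewrite lee_fin.
- by apply/disj_setPCl.
rewrite [X in (_ + X)%E](_ : _ = 0%E) ?adde0//.
apply: null_set_integral => //.
- by apply: measurableC; exact: measurable_Cplus.
- by apply/measurable_EFinP; exact: measurable_funTS.
Qed.

Lemma integral_Laplace_le (f : R -> Cborel R) (k : R) :
  measurable_fun (`]0, 1[ : set R) f -> unit_modular alpha f k ->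
  (\int[nu]_z (cmod (Laplace (extend0 f) z) ^+ 2)%:E <=
    (upper_const * k ^+ 2)%:E * carleson_testing alpha nu)%E.
Proof.
move=> mf fk; have k0 : 0 < k by case: fk.
have C0 : 0 < upper_const * k ^+ 2 :> R by rewrite mulr_gt0 ?upper_const_gt0// exprn_gt0.
have CE : (0 < (upper_const * k ^+ 2)%:E)%E by rewrite lte_fin.
have su := sqint_component alpha1 mf fk (erefl _) measurable_Re normr_Re_le.
have sv := sqint_component alpha1 mf fk (erefl _) measurable_Im normr_Im_le.
pose h (z : Cborel R) := cmod (Laplace (extend0 f) z) ^+ 2.
have mh : measurable_fun setT h.
  by apply: measurable_funX; apply: measurable_fun_cmod; exact: measurable_Laplace.
have h0 z : 0 <= h z by exact: sqr_ge0.
rewrite (integral_Cplus mh h0) Cplus_level ge0_integral_bigcup//=; last 4 first.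
- by move=> n; exact: measurable_level.
- by apply/measurable_EFinP; exact: measurable_funTS.
- by move=> z _; rewrite lee_fin.
- exact: trivIset_level.
have I0 n : (0 <= \int[nu]_(z in level n) (h z)%:E)%E.
  by apply: integral_ge0 => z _; rewrite lee_fin.
rewrite nneseries_recl// addeC.
have car0 n : (0 <= carleson 2 (strip_part nu n%:Z))%E by apply: carleson_ge0 => A; exact: measure_ge0.
have p0 n : (0 < n)%N -> 0 < n%:R `^ (2 / alpha) :> R by move=> n0; rewrite powR_gt0// ltr0n.
rewrite /carleson_testing; set s := ereal_sup _.
have s0 : (0 <= s)%E by exact: base_sup_ge0.
rewrite ge0_muleDr//; last first.
  by apply: nneseries_ge0 => n _ _; rewrite mule_ge0 ?lee_fin ?powR_ge0.
apply: leeD.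
- rewrite -nneseriesZl; last by move=> n _; rewrite mule_ge0 ?lee_fin ?powR_ge0.
  rewrite eseries_cond [leRHS]eseries_cond.
  apply: lee_nneseries => [n _ _|n /= n1]; first exact: I0.
  have := fun l => nu_cell_strip nu l n1; have := car0 n.
  case: (carleson 2 _) => [r| |]//= r0 nuc; last first.
    have pn : (0 < (n%:R `^ (2 / alpha))%:E)%E by rewrite lte_fin p0.
    by rewrite (gt0_muley pn) (gt0_muley CE) leey.
  rewrite -!EFinM; apply: (le_trans (integral_level_Laplace alpha1 mf fk (M := r) _)).
    by move=> l; apply: (le_trans (nuc l)); rewrite -EFinM mulrC.
  by rewrite lee_fin (maxn_idPl n1).
- have := nu_cell_base nu; rewrite -/s; case: s s0 => [r| |]//= r0 nuc; last first.
    by rewrite (gt0_muley CE) leey.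
  apply: (le_trans (integral_level_Laplace alpha1 mf fk (M := r) _)).
    move=> l; apply: (le_trans (nuc l)); rewrite -EFinM lee_fin ler_wpM2r//.
    by rewrite expn0 expr1n mulr1 ler_nat.
  by rewrite -EFinM lee_fin max0n powR1 mul1r.
Qed.

End upper_bound.

Section upper_bound_norm.
Local Open Scope complex_scope.
Context {R : realType}.
Variable alpha : R.
Hypothesis alpha1 : 1 < alpha.
Variable nu : {measure set (Cborel R) -> \bar R}.
Hypothesis nuC : carried_by_Cplus nu.

Lemma Orlicz_normE (f : R -> Cborel R) :
  Orlicz_norm (Phi alpha) f = inf [set k | unit_modular alpha f k].
Proof. by []. Qed.

(** The norm inequality for one [f] follows from those for all [k] of unit modular by
taking the infimum over [k]. *)
Lemma Laplace_bound_testing (T : R) : carleson_testing alpha nu = T%:E ->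
  Laplace_bound (Phi alpha) nu (Num.sqrt (upper_const * T)).
Proof.
move=> TE f of_; have [mf _] := of_; have [k0 fk0] := Orlicz_modular alpha1 of_.
have T0 : 0 <= T by rewrite -lee_fin -TE; exact: carleson_testing_ge0.
have CT0 : 0 <= upper_const * T by rewrite mulr_ge0// ltW// upper_const_gt0.
set M := Num.sqrt _; have M0 : 0 <= M by exact: sqrtr_ge0.
split.
  apply: measurable_funTS; apply: measurable_Laplace.
    exact: (sqint_component alpha1 mf fk0 (erefl _) measurable_Re normr_Re_le).
  exact: (sqint_component alpha1 mf fk0 (erefl _) measurable_Im normr_Im_le).
have le k : unit_modular alpha f k -> (L2norm nu (Laplace (extend0 f)) <= (M * k)%:E)%E.
  move=> fk; have k_ge0 : 0 <= k by case: fk => /ltW.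
  rewrite -lee_sqr_EFin ?Lnorm_ge0 ?mulr_ge0// L2norm_sqr.
  apply: (le_trans (integral_Laplace_le alpha1 nuC mf fk)).
  by rewrite TE -EFinM lee_fin exprMn sqr_sqrtr// mulrAC.
have := le _ fk0; have := Lnorm_ge0 nu 2%:E (fun z => (cmod (Laplace (extend0 f) z))%:E).
rewrite -/(L2norm nu (Laplace (extend0 f))).
case: (L2norm _ _) le => [l| |]// le l0 _.
rewrite Orlicz_normE lee_fin.
have [M00|M_neq0] := eqVneq M 0.
  by have := le _ fk0; rewrite M00 !mul0r lee_fin.
have Mgt0 : 0 < M by rewrite lt_def M_neq0.
rewrite mulrC -ler_pdivrMr//; apply: lb_le_inf; first by exists k0.
by move=> k /le; rewrite lee_fin ler_pdivrMr// mulrC.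
Qed.

End upper_bound_norm.

(** * Choice of signs *)

Section signs.
Local Open Scope complex_scope.
Context {R : realType} d (T : measurableType d) (nu : {measure set T -> \bar R}).

(** Signs for which the square norm of a signed sum is at least the sum of the square norms.
They are chosen one after the other: by the parallelogram identity, one of the two values
A + a and A - a has square norm at least that of A plus that of a. The sequences [a] and [b]
are the real and imaginary parts of the summands. *)
Lemma parallelogram_signs (a b : nat -> T -> R) K :
  (forall n, measurable_fun setT (a n)) -> (forall n, measurable_fun setT (b n)) ->
  exists2 e : nat -> R, (forall n, e n ^+ 2 = 1) &
    (\sum_(n < K) \int[nu]_z (a n z ^+ 2 + b n z ^+ 2)%:E <=
     \int[nu]_z ((\sum_(n < K) e n * a n z) ^+ 2 + (\sum_(n < K) e n * b n z) ^+ 2)%:E)%E.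
Proof.
move=> ma mb; elim: K => [|K [e e2 IH]].
  exists (fun=> 1); first by move=> n; rewrite expr1n.
  by rewrite big_ord0; apply: integral_ge0 => z _; rewrite lee_fin addr_ge0 ?sqr_ge0.
pose A z := \sum_(n < K) e n * a n z; pose B z := \sum_(n < K) e n * b n z.
have mA : measurable_fun setT A.
  by apply: measurable_sum => n; apply: measurable_funM.
have mB : measurable_fun setT B.
  by apply: measurable_sum => n; apply: measurable_funM.
pose I (c : R) := (\int[nu]_z ((A z + c * a K z) ^+ 2 + (B z + c * b K z) ^+ 2)%:E)%E.
have ext c : c ^+ 2 = 1 -> (\sum_(n < K.+1) \int[nu]_z (a n z ^+ 2 + b n z ^+ 2)%:E <= I c)%E ->
    exists2 e : nat -> R, (forall n, e n ^+ 2 = 1) &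
    (\sum_(n < K.+1) \int[nu]_z (a n z ^+ 2 + b n z ^+ 2)%:E <=
     \int[nu]_z ((\sum_(n < K.+1) e n * a n z) ^+ 2 + (\sum_(n < K.+1) e n * b n z) ^+ 2)%:E)%E.
  move=> c2 H; exists (fun n => if n == K then c else e n); first by move=> n; case: ifP.
  apply: (le_trans H); rewrite le_eqVlt; apply/orP; left; apply/eqP; apply: eq_integral => z _.
  by congr ((_ + _) %:E); rewrite big_ord_recr/= eqxx; congr ((_ + _) ^+ 2);
    apply: eq_bigr => n _; rewrite ltn_eqF.
have mI c : measurable_fun setT (fun z => ((A z + c * a K z) ^+ 2 + (B z + c * b K z) ^+ 2)%:E).
  apply/measurable_EFinP; apply: measurable_funD; apply: measurable_funX;
    by apply: measurable_funD => //; apply: measurable_funM.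
have E : (I 1%R + I (-1)%R = 2%:E * \int[nu]_z (A z ^+ 2 + B z ^+ 2)%:E +
    2%:E * \int[nu]_z (a K z ^+ 2 + b K z ^+ 2)%:E)%E.
  rewrite -ge0_integralD//; last 2 first.
    by move=> z _; rewrite lee_fin addr_ge0 ?sqr_ge0.
    by move=> z _; rewrite lee_fin addr_ge0 ?sqr_ge0.
  rewrite -!ge0_integralZl//; last 4 first.
    apply/measurable_EFinP; apply: measurable_funD; exact: measurable_funX.
    by move=> z _; rewrite lee_fin addr_ge0 ?sqr_ge0.
    apply/measurable_EFinP; apply: measurable_funD; exact: measurable_funX.
    by move=> z _; rewrite lee_fin addr_ge0 ?sqr_ge0.
  rewrite -ge0_integralD//; last 4 first.
    by move=> z _; rewrite -EFinM lee_fin mulr_ge0// addr_ge0 ?sqr_ge0.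
    by apply: measurable_funeM; apply/measurable_EFinP; apply: measurable_funD; exact: measurable_funX.
    by move=> z _; rewrite -EFinM lee_fin mulr_ge0// addr_ge0 ?sqr_ge0.
    by apply: measurable_funeM; apply/measurable_EFinP; apply: measurable_funD; exact: measurable_funX.
  by apply: eq_integral => z _; rewrite -!EFinM -!EFinD; congr _%:E; ring.
set S := (\sum_(n < K.+1) _)%E.
have SE : (S + S <= I 1%R + I (-1)%R)%E.
  rewrite E !mule_natl !mule2n addeACA.
  by rewrite /S big_ord_recr/=; apply: leeD; apply: leeD.
have [S1|S1] := leP S (I 1); first by apply: (ext 1) => //; rewrite expr1n.
have [S2|S2] := leP S (I (-1)); first by apply: (ext (-1)) => //; rewrite sqrrN expr1n.
by have := lteD S1 S2; rewrite ltNge SE.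
Qed.

End signs.

(** * Test functions *)

Section bumps.
Local Open Scope complex_scope.
Context {R : realType}.
Notation mu := (@lebesgue_measure R).
Variable alpha : R.
Hypothesis alpha1 : 1 < alpha.
Let alpha0 : 0 < alpha. Proof. exact: lt_trans alpha1. Qed.
Variables (K : nat) (e y : nat -> R).
Hypothesis e2 : forall n, e n ^+ 2 = 1.
Implicit Types (n m : nat) (t x : R).

(** The dyadic intervals are open, so that they all lie in the open unit interval. *)
Definition dyadic n : set R := `]2 ^- n.+1, 2 ^- n[%classic.

(** The amplitude n^(1/alpha), shifted by one so that n = 0 is allowed. For n >= 1 it has
the size of (log 1/t)^(1/alpha) on the n-th dyadic interval. *)
Definition amp n : R := n.+1%:R `^ alpha^-1.

(** The real ([s = false]) and imaginary ([s = true]) parts of the modulated bump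
amp n * exp(i (y n) t) on the n-th dyadic interval. *)
Definition bump (s : bool) n t : R := amp n * (\1_(dyadic n) t * trig s (y n * t)).

Definition bump_sum s t : R := \sum_(n < K) e n * bump s n t.

(** The test function: a signed sum of bumps modulated at arbitrary frequencies [y n]. *)
Definition test_fun t : Cborel R := bump_sum false t +i* bump_sum true t.

Lemma measurable_dyadic n : measurable (dyadic n : set R).
Proof. exact: measurable_itv. Qed.

Lemma dyadic_unit n t : dyadic n t -> 0 < t < 1.
Proof.
rewrite /dyadic/= in_itv/= => /andP[nt tn]; rewrite (lt_trans _ nt) ?invr_gt0 ?exprn_gt0//=.
by apply: (lt_le_trans tn); rewrite invf_le1 ?exprn_gt0// exprn_ege1// ler1n.
Qed.

Lemma dyadic_inj n m t : dyadic n t -> dyadic m t -> n = m.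
Proof.
wlog nm : n m / (n <= m)%N.
  by move=> H nt mt; have [/H->//|/ltnW/H->] := leqP n m.
move: nm; rewrite leq_eqVlt => /predU1P[//|nm].
rewrite /dyadic/= !in_itv/= => /andP[nt _] /andP[_ tm].
have := lt_trans nt tm; rewrite ltf_pV2 ?posrE ?exprn_gt0// ltr_eXn2l ?ltr1n//.
by rewrite ltnNge nm.
Qed.

Lemma measurable_bump s n : measurable_fun setT (bump s n).
Proof.
apply: measurable_funM => //; apply: measurable_funM; last exact: measurable_trig.
by apply: measurable_indic; exact: measurable_dyadic.
Qed.

Lemma sqint_bump s n a b : sqint a b (bump s n).
Proof.
apply: (@sqint_bounded _ _ _ _ (amp n)); first by apply: measurable_funTS; exact: measurable_bump.
move=> t _; rewrite normrM ger0_norm ?powR_ge0// ler_piMr ?powR_ge0//.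
rewrite normrM; apply: mulr_ile1 => //; last exact: trig_le1.
by rewrite indicE; case: (_ \in _); rewrite ?normr1 ?normr0.
Qed.

Lemma sqint_sum a b (g : nat -> R -> R) k : (forall n, sqint a b (g n)) ->
  sqint a b (fun t => \sum_(n < k) e n * g n t).
Proof.
move=> sg; elim: k => [|k IH].
  under [X in sqint _ _ X]funext do rewrite big_ord0.
  by apply: (@sqint_bounded _ _ _ _ 0) => // t _; rewrite normr0.
under [X in sqint _ _ X]funext do rewrite big_ord_recr.
by apply: sqintD => //; exact: sqintZ.
Qed.

Lemma damped_int_sum x s w (g : nat -> R -> R) k a b : (forall n, sqint a b (g n)) ->
  damped_int x s w (fun t => \sum_(n < k) e n * g n t) a b =
  \sum_(n < k) e n * damped_int x s w (g n) a b.
Proof.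
move=> sg; elim: k => [|k IH].
  rewrite big_ord0 /damped_int (_ : \int[mu]_(t in _) _ = \int[mu]_(t in `[a, b]) (cst 0 t)).
    by rewrite Rintegral_cst// mul0r.
  by apply: eq_Rintegral => t _; rewrite big_ord0 mul0r.
rewrite big_ord_recr/= -IH /damped_int -RintegralDr; last 2 first.
- by apply: integrable_damped; exact: sqint_sum.
- exact: integrable_damped.
by apply: eq_Rintegral => t _; rewrite big_ord_recr/= mulrDl mulrA.
Qed.

Lemma bump0 s n t : t \notin `]0, 1[ -> bump s n t = 0.
Proof.
rewrite in_itv/= => t01; rewrite /bump indicE memNset ?mul0r ?mulr0//.
by move=> /dyadic_unit; apply/negP.
Qed.

Lemma extend0_test_fun t : extend0 test_fun t = test_fun t.
Proof.
rewrite /extend0; case: ifPn => // t01; rewrite /test_fun /bump_sum.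
by rewrite !big1// => n _; rewrite bump0// mulr0.
Qed.

(** The real part of the Laplace transform of the n-th bump. *)
Definition bump_re n (z : R[i]) : R :=
  damped_int (complex.Re z) false (complex.Im z) (bump false n) 0 pi +
  damped_int (complex.Re z) true (complex.Im z) (bump true n) 0 pi.

(** The imaginary part of the Laplace transform of the n-th bump. *)
Definition bump_im n (z : R[i]) : R :=
  damped_int (complex.Re z) false (complex.Im z) (bump true n) 0 pi -
  damped_int (complex.Re z) true (complex.Im z) (bump false n) 0 pi.

Lemma Laplace_test_fun (z : R[i]) : Laplace (extend0 test_fun) z =
  (\sum_(n < K) e n * bump_re n z) +i* (\sum_(n < K) e n * bump_im n z).
Proof.
case: z => x w; rewrite Laplace_damped.
- rewrite (_ : (fun t => complex.Re (extend0 test_fun t)) = bump_sum false); last first.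
    by apply/funext => t; rewrite extend0_test_fun.
  rewrite (_ : (fun t => complex.Im (extend0 test_fun t)) = bump_sum true); last first.
    by apply/funext => t; rewrite extend0_test_fun.
  have sb s n := sqint_bump s n 0 pi.
  rewrite /bump_sum !damped_int_sum// -big_split/= -sumrB.
  congr (_ +i* _); apply: eq_bigr => n _.
    by rewrite /bump_re/= mulrDr.
  by rewrite /bump_im/= mulrBr.
- under [X in sqint _ _ X]funext do rewrite extend0_test_fun.
  by apply: sqint_sum => n; exact: sqint_bump.
- under [X in sqint _ _ X]funext do rewrite extend0_test_fun.
  by apply: sqint_sum => n; exact: sqint_bump.
Qed.

End bumps.

Section bump_estimates.
Local Open Scope complex_scope.
Context {R : realType}.
Notation mu := (@lebesgue_measure R).
Variable alpha : R.
Hypothesis alpha1 : 1 < alpha.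
Let alpha0 : 0 < alpha. Proof. exact: lt_trans alpha1. Qed.
Variables (K : nat) (e y : nat -> R).
Hypothesis e2 : forall n, e n ^+ 2 = 1.
Implicit Types (n m : nat) (t x : R).

Local Notation f := (test_fun alpha K e y).

Lemma cmod_test_fun n t : (n < K)%N -> dyadic n t -> cmod (f t) = amp alpha n.
Proof.
move=> nK nt.
have bs s : bump_sum alpha K e y s t = e n * (amp alpha n * trig s (y n * t)).
  rewrite /bump_sum (bigD1 (Ordinal nK))//= big1 ?addr0; last first.
    move=> m mn; rewrite /bump indicE memNset ?mul0r ?mulr0// => mt.
    by move/eqP: mn; apply; apply/val_inj/(dyadic_inj mt nt).
  by rewrite /bump indicE mem_set// mul1r.
have a0 : 0 <= amp alpha n by exact: powR_ge0.
apply/eqP; rewrite -(@eqrXn2 _ 2)// ?cmod_ge0//; apply/eqP.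
rewrite sqr_cmod/= !bs !exprMn e2 !mul1r -mulrDr.
by rewrite /trig cos2Dsin2 mulr1.
Qed.

Lemma cmod_test_fun0 t : (forall n, (n < K)%N -> ~ dyadic n t) -> cmod (f t) = 0.
Proof.
move=> H; have bs s : bump_sum alpha K e y s t = 0.
  rewrite /bump_sum big1// => m _; rewrite /bump indicE memNset ?mul0r ?mulr0//.
  exact: H.
by rewrite /cmod/= !bs expr0n addr0 sqrtr0.
Qed.

Lemma measurable_test_fun : measurable_fun setT f.
Proof.
by apply: measurable_fun_complex => //; apply: measurable_sum => n;
   apply: measurable_funM => //; exact: measurable_bump.
Qed.

(** A bound of the Orlicz norm of all test functions, whatever their signs, frequencies and
number of bumps. *)
Definition test_radius : R := 8 `^ alpha^-1.

Lemma expR_quarter_le : expR 4^-1 <= 4 / 3 :> R.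
Proof.
have -> : expR 4^-1 = (expR (- 4^-1))^-1 :> R by rewrite expRN invrK.
rewrite -[4 / 3]invf_div lef_pV2 ?posrE ?expR_gt0 ?divr_gt0//.
by have := expR_ge1Dx (- 4^-1 : R); lra.
Qed.

Lemma Phi_amp n : Phi alpha (test_radius^-1 * amp alpha n) <= 2^-1 * (4 / 3) ^+ n.+1.
Proof.
set a := alpha^-1.
have -> : test_radius^-1 * amp alpha n = 2^-1 `^ a * (n.+1%:R / 4) `^ a.
  rewrite /test_radius /amp -/a -powRM// ?mulr_ge0//.
  have -> : 2^-1 * (n.+1%:R / 4) = 8^-1 * n.+1%:R :> R by field.
  rewrite powRM// ?invr_ge0//; congr (_ * _).
  have p8 : 0 < 8 `^ a :> R by exact: powR_gt0.
  apply: (mulIf (lt0r_neq0 p8)); rewrite mulVf ?gt_eqF// -powRM ?invr_ge0//.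
  by rewrite mulVf ?powR1.
have h01 : 0 <= (2^-1 : R) <= 1 by rewrite invr_ge0 ler0n invf_le1 ?ler1n.
apply: (le_trans (Phi_scale alpha1 h01 (powR_ge0 _ _))).
rewrite ler_pM2l ?invr_gt0// /Phi -powRrM mulVf ?gt_eqF// powRr1 ?divr_ge0//.
apply: (@le_trans _ _ (expR (n.+1%:R / 4))).
  by rewrite lerBlDr lerBlDr -addrA lerDl addr_ge0// divr_ge0.
by rewrite mulrC expRM_natr lerXn2r ?nnegrE ?expR_ge0 ?divr_ge0// expR_quarter_le.
Qed.

Lemma sum_two_thirds k : \sum_(n < k) (2 / 3) ^+ n.+1 <= 2 :> R.
Proof.
suff -> : \sum_(n < k) (2 / 3) ^+ n.+1 = 2 - 2 * (2 / 3) ^+ k :> R.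
  by rewrite lerBlDr lerDl mulr_ge0// exprn_ge0// divr_ge0.
elim: k => [|k IH]; first by rewrite big_ord0 expr0 mulr1 subrr.
by rewrite big_ord_recr/= IH exprS; field.
Qed.

Lemma lebesgue_measure_dyadic n : mu (dyadic n) = (2 ^- n.+1)%:E.
Proof.
rewrite /dyadic /= lebesgue_measure_itv/= lte_fin ltf_pV2 ?posrE ?exprn_gt0// ltr_eXn2l ?ltr1n//.
rewrite ltnS leqnn -EFinB; congr _%:E; rewrite exprS.
have : 2 ^+ n != 0 :> R by rewrite expf_neq0.
by move: (2 ^+ n) => p p0; field.
Qed.

(** The modulus takes the value amp n on the n-th dyadic interval, of length 2^-(n+1), so
the modular is at most half the sum of the powers (2/3)^(n+1). *)
Lemma unit_modular_test_fun : unit_modular alpha f test_radius.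
Proof.
split; first exact: powR_gt0.
pose c n : R := 2^-1 * (4 / 3) ^+ n.+1.
have c0 n : 0 <= c n by rewrite mulr_ge0 ?invr_ge0// exprn_ge0// divr_ge0.
have mI n : measurable_fun (`]0, 1[%classic : set R) (fun t => (c n * \1_(dyadic n) t)%:E).
  apply/measurable_EFinP; apply: measurable_funM => //.
  by apply: measurable_indic; exact: measurable_dyadic.
apply: (@le_trans _ _ (\int[mu]_(t in `]0%R, 1%R[) \sum_(n < K) (c n * \1_(dyadic n) t)%:E)%E).
  apply: ge0_le_integral => //.
  - by move=> t _; rewrite lee_fin Phi_ge0.
  - apply/measurable_EFinP; apply: measurable_Phi_cmod.
    by apply: measurable_funTS; exact: measurable_test_fun.
  - by apply: emeasurable_sum => n; exact: mI.
  - move=> t _; rewrite sumEFin lee_fin.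
    have s0 : 0 <= \sum_(n < K) c n * \1_(dyadic n) t :> R.
      by rewrite sumr_ge0// => n _; rewrite mulr_ge0.
    have [[n nK nt]|H] := pselect (exists2 n, (n < K)%N & dyadic n t); last first.
      by rewrite cmod_test_fun0 ?mulr0 ?Phi0// => n nK nt; apply: H; exists n.
    rewrite (cmod_test_fun nK nt); apply: (le_trans (Phi_amp n)).
    rewrite (bigD1 (Ordinal nK))//= indicE mem_set// mulr1 lerDl.
    by rewrite sumr_ge0// => m _; rewrite mulr_ge0.
rewrite ge0_integral_sum//; last 2 first.
- by move=> n; exact: mI.
- by move=> n t _; rewrite lee_fin mulr_ge0.
apply: (@le_trans _ _ (\sum_(n < K) (2^-1 * (2 / 3) ^+ n.+1)%:E)%E).
  apply: lee_sum => n _.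
  under eq_integral do rewrite EFinM.
  rewrite ge0_integralZl//; last 2 first.
    apply: (@measurableT_comp _ _ _ _ _ _ EFin) => //.
    by apply: measurable_indic; exact: measurable_dyadic.
    by rewrite lee_fin.
  rewrite integral_indic//; last exact: measurable_dyadic.
  apply: (@le_trans _ _ ((c n)%:E * (2 ^- n.+1)%:E)%E).
    rewrite lee_wpmul2l ?lee_fin// -lebesgue_measure_dyadic.
    apply: le_measure; rewrite ?inE//; first by apply: measurableI => //; exact: measurable_dyadic.
      exact: measurable_dyadic.
  rewrite -EFinM lee_fin /c -mulrA ler_pM2l ?invr_gt0// -exprVn -exprMn.
  by rewrite (_ : 4 / 3 / 2 = 2 / 3)//; field.
by rewrite sumEFin lee_fin -mulr_sumr ler_pdivrMl// mulr1 sum_two_thirds.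
Qed.

Lemma Orlicz_test_fun : Orlicz (Phi alpha) f.
Proof.
have mf : measurable_fun (`]0, 1[%classic : set R) f.
  by apply: measurable_funTS; exact: measurable_test_fun.
have [k0 le1] := unit_modular_test_fun.
split => //; exists test_radius => //; apply/integrableP; split.
  by apply/measurable_EFinP; exact: measurable_Phi_cmod.
apply: (@le_lt_trans _ _ 1%E); last exact: ltry.
apply: le_trans le1; rewrite le_eqVlt; apply/orP; left; apply/eqP; apply: eq_integral => t _ /=.
by rewrite ger0_norm// Phi_ge0.
Qed.

Lemma Orlicz_norm_test_fun : 0 <= Orlicz_norm (Phi alpha) f <= test_radius.
Proof.
have lb : lbound [set k | unit_modular alpha f k] 0 by move=> k [/ltW].
apply/andP; split.
  by apply: lb_le_inf => //; exists test_radius; exact: unit_modular_test_fun.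
by apply: ge_inf; [exists 0|exact: unit_modular_test_fun].
Qed.

Lemma cos_ge_cos1 (x : R) : `|x| <= 1 -> cos 1 <= cos x.
Proof.
move=> x1; rewrite -(cos_norm x) leNgt ltr_cos ?in_itv/= -?leNgt//.
- by rewrite ler01 (le_trans _ (pi_ge2 R))// ler1n.
- by apply/andP; split => //; rewrite (le_trans x1)// (le_trans _ (pi_ge2 R))// ler1n.
Qed.

(** On the n-th level and near the frequency [y n], the kernel has almost constant argument on
the n-th dyadic interval: there x t <= 2 and |w - y n| t <= 1. *)
Lemma bump_re_ge n (z : R[i]) : 0 <= complex.Re z <= 2 ^+ n.+1 ->
  `|complex.Im z - y n| <= 2 ^+ n ->
  amp alpha n * (expR (- 2) * cos 1) * 2 ^- n.+1 <= bump_re alpha y n z.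
Proof.
case: z => x w /= /andP[x0 xn] wy.
have sb s : sqint 0 pi (bump alpha y s n) by exact: sqint_bump.
rewrite /bump_re/= /damped_int -RintegralD//; [|exact: integrable_damped|exact: integrable_damped].
set c := amp alpha n * (expR (- 2) * cos 1).
have sub : dyadic n `&` `[0, pi]%classic = dyadic n :> set R.
  apply/setIidPl => t /dyadic_unit /andP[t0 t1]; rewrite /= in_itv/= (ltW t0)/=.
  by rewrite (le_trans (ltW t1))// (le_trans _ (pi_ge2 R))// ler1n.
have i1 : mu.-integrable `[0, pi] (EFin \o (\1_(dyadic n) : R -> R)).
  apply: (@integrable_bounded_itv _ _ _ _ 1).
    by apply: measurable_indic; exact: measurable_dyadic.
  by move=> t _; rewrite indicE; case: (_ \in _); rewrite ?normr1 ?normr0.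
have -> : c * 2 ^- n.+1 = \int[mu]_(t in `[0, pi]) (c * \1_(dyadic n) t).
  rewrite RintegralZl//; congr (_ * _); rewrite /Rintegral integral_indic//.
    rewrite sub; transitivity (fine (2 ^- n.+1 : R)%:E) => //.
    by congr fine; exact/esym/lebesgue_measure_dyadic.
  exact: measurable_dyadic.
apply: le_Rintegral => //.
- exact: integrable_mull.
- by apply: integrable_addr; exact: integrable_damped.
move=> t _; rewrite /bump /damped /trig indicE.
have [nt|nt] := boolP (t \in dyadic n); last by rewrite !(mul0r, mulr0) addr0.
move: nt; rewrite inE => nt.
have /andP[t0 _] := dyadic_unit nt.
have tn : t <= 2 ^- n by move: nt; rewrite /dyadic/= in_itv/= => /andP[_ /ltW].
rewrite !mul1r mulr1.
have -> : amp alpha n * cos (y n * t) * (expR (- x * t) * cos (w * t)) +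
   amp alpha n * sin (y n * t) * (expR (- x * t) * sin (w * t)) =
   amp alpha n * (expR (- x * t) * cos ((w - y n) * t)).
  by rewrite mulrBl cosB; ring.
rewrite /c ler_wpM2l ?powR_ge0//; apply: ler_pM; rewrite ?expR_ge0 ?(ltW (cos1_gt0 R))//.
- rewrite ler_expR mulNr lerN2.
  apply: (@le_trans _ _ (2 ^+ n.+1 * 2 ^- n)); first by rewrite ler_pM// ltW.
  by rewrite exprS -mulrA divff ?mulr1// expf_neq0.
- apply: cos_ge_cos1; rewrite normrM (gtr0_norm t0).
  apply: (@le_trans _ _ (2 ^+ n * 2 ^- n)); first by rewrite ler_pM// ltW.
  by rewrite divff// expf_neq0.
Qed.

End bump_estimates.

(** * The lower bound *)

Section lower_bound.
Local Open Scope complex_scope.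
Context {R : realType}.
Variable alpha : R.
Hypothesis alpha1 : 1 < alpha.
Let alpha0 : 0 < alpha. Proof. exact: lt_trans alpha1. Qed.
Variable nu : {measure set (Cborel R) -> \bar R}.
Implicit Types (n k K : nat) (y : R).

(** The closure on the right of [level], which contains the whole boxes of side 2 for n = 0. *)
Definition level_range n : set (Cborel R) :=
  [set z | (if n is 0 then 0 < complex.Re (z : R[i]) else 2 ^+ n <= complex.Re (z : R[i]))
    && (complex.Re (z : R[i]) <= 2 ^+ n.+1)].

(** The part of a level within distance 2^n of the height [y]. *)
Definition level_box n y : set (Cborel R) :=
  level_range n `&` [set z | `|complex.Im (z : R[i]) - y| <= 2 ^+ n].

Lemma measurable_level_range n : measurable (level_range n).
Proof.
case: n => [|n].
  have := @measurable_preimage_Re R `]0, 2 ^+ 1]%classic (measurable_itv _).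
  by congr measurable; apply/seteqP; split=> z /=; rewrite in_itv/=.
have := @measurable_preimage_Re R `[2 ^+ n.+1, 2 ^+ n.+2]%classic (measurable_itv _).
by congr measurable; apply/seteqP; split=> z /=; rewrite in_itv/=.
Qed.

Lemma measurable_level_box n y : measurable (level_box n y).
Proof.
apply: measurableI; first exact: measurable_level_range.
rewrite (_ : [set z | _] = [set z | `[y - 2 ^+ n, y + 2 ^+ n]%classic (complex.Im (z : R[i]))]).
  exact: measurable_preimage_Im.
by apply/seteqP; split=> z /=; rewrite in_itv/= ler_distl.
Qed.

Lemma level_range_Re n (z : R[i]) : level_range n z -> 0 <= complex.Re z <= 2 ^+ n.+1.
Proof.
rewrite /level_range/=; case: n => [|n] /andP[z0 ->]; rewrite andbT; first exact: ltW.
by apply: le_trans z0; rewrite exprn_ge0.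
Qed.

Definition test_const : R := (expR (- 2) * cos 1 / 2) ^+ 2.

Lemma test_const_gt0 : 0 < test_const.
Proof. by rewrite exprn_gt0// divr_gt0// mulr_gt0 ?expR_gt0 ?cos1_gt0. Qed.

(** A lower bound of the square of the transform of the n-th bump on its box. *)
Definition level_weight n : R := test_const * (n.+1%:R `^ (2 / alpha) * 4 ^- n).

Lemma level_weight_gt0 n : 0 < level_weight n.
Proof.
by rewrite mulr_gt0 ?test_const_gt0// mulr_gt0 ?powR_gt0 ?invr_gt0 ?exprn_gt0.
Qed.

Lemma bump_sqr_ge n (y : nat -> R) (z : Cborel R) : level_box n (y n) z ->
  level_weight n <= bump_re alpha y n z ^+ 2 + bump_im alpha y n z ^+ 2.
Proof.
move=> [zr zy]; have := bump_re_ge alpha (level_range_Re zr) zy.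
set c := amp alpha n * _ * _ => cb.
have c0 : 0 <= c.
  by rewrite mulr_ge0 ?invr_ge0 ?exprn_ge0// mulr_ge0 ?powR_ge0// mulr_ge0 ?expR_ge0// ltW// cos1_gt0.
apply: (@le_trans _ _ (bump_re alpha y n z ^+ 2)); last by rewrite lerDl sqr_ge0.
apply: (@le_trans _ _ (c ^+ 2)); last by rewrite ler_sqr ?nnegrE// (le_trans c0).
rewrite le_eqVlt; apply/orP; left; apply/eqP.
have -> : level_weight n = test_const * (amp alpha n ^+ 2 * 4 ^- n).
  rewrite /level_weight; congr (_ * (_ * _)).
  by rewrite /amp -powR_mulrn ?powR_ge0// -powRrM mulrC.
rewrite /c /test_const (_ : 4 ^- n = (2 ^- n) ^+ 2); last first.
  rewrite exprVn exprAC; congr ((_ ^+ _)^-1); ring.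
rewrite (exprS 2 n); have : 2 ^+ n != 0 :> R by rewrite expf_neq0.
by move: (2 ^+ n) (expR _) (cos _) (amp _ _) => p E C A p0; field.
Qed.

Variable M : R.
Hypothesis M0 : 0 <= M.
Hypothesis LM : Laplace_bound (Phi alpha) nu M.

Lemma test_radius_sqr_le : test_radius alpha ^+ 2 <= 64 :> R.
Proof.
have r8 : test_radius alpha <= 8 :> R.
  by apply: ler1_powR; rewrite ?ler1n// invf_le1// ltW.
rewrite (_ : 64 = 8 ^+ 2); last by rewrite -natrX.
by rewrite ler_sqr ?nnegrE ?powR_ge0.
Qed.

(** The boundedness hypothesis tested on [test_fun], for arbitrary heights [y]. *)
Lemma sum_level_box_le K (y : nat -> R) :
  (\sum_(n < K) (level_weight n)%:E * nu (level_box n (y n)) <= (64 * M ^+ 2)%:E)%E.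
Proof.
have mb s s' n : measurable_fun setT (fun z : Cborel R =>
    damped_int (complex.Re (z : R[i])) s (complex.Im (z : R[i])) (bump alpha y s' n) 0 pi).
  by apply: measurable_damped_int; exact: sqint_bump.
have mre n : measurable_fun setT (bump_re alpha y n : Cborel R -> R) by exact: measurable_funD.
have mim n : measurable_fun setT (bump_im alpha y n : Cborel R -> R) by exact: measurable_funB.
have [e e2 le] := parallelogram_signs nu K mre mim.
have Of := Orlicz_test_fun alpha1 K y e2.
have /andP[N0 N1] := Orlicz_norm_test_fun alpha1 K y e2.
have [_ L2] := LM Of.
have : (L2norm nu (Laplace (extend0 (test_fun alpha K e y))) ^+ 2 <= (64 * M ^+ 2)%:E)%E.
  apply: (@le_trans _ _ (((M * Orlicz_norm (Phi alpha) (test_fun alpha K e y)) ^+ 2)%:E)).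
    by rewrite lee_sqr_EFin ?Lnorm_ge0 ?mulr_ge0.
  rewrite lee_fin exprMn mulrC ler_wpM2r ?sqr_ge0//.
  by apply: le_trans test_radius_sqr_le; rewrite ler_sqr ?nnegrE// (le_trans N0).
rewrite L2norm_sqr; apply: le_trans.
apply: (@le_trans _ _ (\int[nu]_z ((\sum_(n < K) e n * bump_re alpha y n z) ^+ 2 +
  (\sum_(n < K) e n * bump_im alpha y n z) ^+ 2)%:E)%E); last first.
  rewrite le_eqVlt; apply/orP; left; apply/eqP; apply: eq_integral => z _.
  by rewrite (Laplace_test_fun alpha K e y (z : R[i])) sqr_cmod.
apply: le_trans le; apply: lee_sum => n _.
have mB := measurable_level_box n (y n).
apply: (@le_trans _ _ (\int[nu]_(z in level_box n (y n)) (bump_re alpha y n z ^+ 2 + bump_im alpha y n z ^+ 2)%:E)%E).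
  rewrite -integral_cst//; apply: ge0_le_integral => //.
  - by move=> z _; rewrite lee_fin ltW// level_weight_gt0.
  - by apply/measurable_EFinP; apply: measurable_funTS; apply: measurable_funD; exact: measurable_funX.
  - by move=> z zb; rewrite lee_fin bump_sqr_ge.
apply: ge0_subset_integral => //.
- by apply/measurable_EFinP; apply: measurable_funD; exact: measurable_funX.
- by move=> z _; rewrite lee_fin addr_ge0 ?sqr_ge0.
Qed.

(** The largest measure of a box of the n-th level. *)
Definition level_sup n : \bar R := ereal_sup [set nu (level_box n y) | y in [set: R]].

Lemma level_box_le_sup n y : (nu (level_box n y) <= level_sup n)%E.
Proof. by apply: ereal_sup_ubound; exists y. Qed.

Lemma level_sup_ge0 n : (0 <= level_sup n)%E.
Proof. exact: le_trans (measure_ge0 nu (level_box n 0)) (level_box_le_sup n 0). Qed.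

Lemma level_sup_fin n : level_sup n \is a fin_num.
Proof.
rewrite ge0_fin_numE ?level_sup_ge0//.
apply: (@le_lt_trans _ _ ((level_weight n)^-1 * (64 * M ^+ 2))%:E); last exact: ltry.
apply: ge_ereal_sup => _ [y _ <-].
rewrite EFinM lee_pdivlMl ?level_weight_gt0//.
apply: le_trans (sum_level_box_le n.+1 (fun=> y)).
rewrite big_ord_recr/= leeDr//; apply: sume_ge0 => k _.
by rewrite mule_ge0 ?measure_ge0// lee_fin ltW// level_weight_gt0.
Qed.

(** The heights are chosen to realise half of each supremum, which is possible because
these are finite. *)
Lemma level_sup_half n : exists y, (level_sup n <= 2%:E * nu (level_box n y))%E.
Proof.
have := level_sup_fin n; have := level_sup_ge0 n; rewrite le_eqVlt => /predU1P[<- _|].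
  by exists 0; rewrite mule_ge0 ?measure_ge0.
case E : (level_sup n) => [r| |]//; rewrite lte_fin => r0 _.
have : ((r / 2)%:E < level_sup n)%E by rewrite E lte_fin ltr_pdivrMr// ltr_pMr// ltr1n.
move=> /ereal_sup_gt[_ [y _ <-]] ry; exists y.
by rewrite -lee_pdivrMl// -EFinM mulrC ltW.
Qed.

Lemma sum_level_sup_le K :
  (\sum_(n < K) (level_weight n)%:E * level_sup n <= (128 * M ^+ 2)%:E)%E.
Proof.
(* For each n a height y n realising half of the supremum. *)
have [y yH] := choice level_sup_half.
apply: (@le_trans _ _ (2%:E * \sum_(n < K) (level_weight n)%:E * nu (level_box n (y n)))%E).
  rewrite ge0_sume_distrr; last first.
    by move=> n _; rewrite mule_ge0 ?measure_ge0// lee_fin ltW// level_weight_gt0.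
  apply: lee_sum => n _; rewrite muleCA lee_wpmul2l// lee_fin ltW// level_weight_gt0//.
rewrite (_ : 128 * M ^+ 2 = 2 * (64 * M ^+ 2)); last by rewrite mulrA -natrM.
by rewrite EFinM lee_wpmul2l// sum_level_box_le.
Qed.

(** The part of a Carleson box in a level is covered by boxes of that level, in number
comparable to the ratio of their sides. *)
Lemma Qbox_level_le n (I : set R) (D : set (Cborel R)) : bounded_interval I ->
  2 ^+ n <= ilength I -> measurable D -> Qbox I `&` D `<=` level_range n ->
  (nu (Qbox I `&` D) <= (2 * (ilength I / 2 ^+ n))%:E * level_sup n)%E.
Proof.
move=> bI nI mD Dn; have l0 := ilength_gt0 bI.
have p0 : 0 < 2 ^+ n :> R by rewrite exprn_gt0.
have mQ : measurable (Qbox I `&` D).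
  by apply: measurableI => //; apply: measurable_Qbox; case: bI.
have [->|/set0P[y0 Iy0]] := eqVneq I set0.
  rewrite (_ : Qbox set0 `&` D = set0) ?measure0; last by apply/seteqP; split => z // [[]].
  by rewrite mule_ge0 ?level_sup_ge0// lee_fin mulr_ge0// divr_ge0 ?ilength_ge0// ltW.
set l := ilength I in nI l0 *.
set q := l / 2 ^+ n.
have q1 : 1 <= q by rewrite ler_pdivlMr// mul1r.
have q0 : 0 <= q by rewrite (le_trans _ q1).
set m := (Num.truncn q).+1.
have qm : q < m%:R by exact: truncnS_gt.
have mq : m%:R <= 2 * q.
  have /andP[tq _] := truncn_itv q0.
  by rewrite /m -natr1; lra.
(* Centres of consecutive segments of length 2^(n+1) covering [y0 - l, y0 + l]. *)
pose c i : R := y0 - l + (2 * i%:R + 1) * 2 ^+ n.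
apply: (@le_trans _ _ (\sum_(i < m) nu (level_box n (c i)))%E).
  apply: (@content_subadditive _ _ _ nu _ (fun i => level_box n (c i)) m) => //.
    by move=> i _; exact: measurable_level_box.
  move=> z [Qz Dz]; have zr : level_range n z by apply: Dn.
  have [Iz _] := Qz.
  set w := complex.Im (z : R[i]) in Iz.
  have wy := interval_dist bI Iy0 Iz; have yw := interval_dist bI Iz Iy0.
  rewrite -/l in wy yw.
  set r := (w - y0 + l) / (2 * 2 ^+ n).
  have p2 : 0 < 2 * 2 ^+ n :> R by rewrite mulr_gt0.
  have r0 : 0 <= r by rewrite divr_ge0 ?(ltW p2)//; lra.
  have rq : r <= q by rewrite /r /q ler_pdivrMr// mulrCA divfK ?gt_eqF//; lra.
  have im : (Num.truncn r < m)%N by rewrite truncn_lt_nat// (le_lt_trans rq).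
  rewrite -(bigcup_mkord m (fun k => level_box n (c k))); exists (Num.truncn r) => //; split => //=.
  have := truncn_itv r0; rewrite -natr1 /r ler_pdivlMr// ltr_pdivrMr//.
  rewrite -/w -/r ler_distl /c; move: (_%:R) (2 ^+ n) => i p /andP[h1 h2].
  by apply/andP; split; lra.
apply: (@le_trans _ _ (\sum_(i < m) level_sup n)%E).
  by apply: lee_sum => i _; exact: level_box_le_sup.
rewrite -(fineK (level_sup_fin n)) sumEFin -EFinM lee_fin sumr_const card_ord.
by rewrite -[leLHS]mulr_natl ler_wpM2r// fine_ge0// level_sup_ge0.
Qed.

Lemma strip_sub_level_range n : (0 < n)%N -> @strip R n%:Z `<=` level_range n.
Proof.
move=> n0 z; rewrite strip_level// /level /level_range/=; case: (n) => [|k] /andP[-> /ltW ->]//.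
Qed.

(** In the n-th strip, Carleson boxes of side less than 2^n are empty, and for larger ones
the ratio to the squared side is largest when the side has order 2^n. *)
Lemma carleson_strip_le n : (0 < n)%N ->
  (carleson 2 (strip_part nu n%:Z) <= (2 * 4 ^- n)%:E * level_sup n)%E.
Proof.
move=> n0; apply: ge_ereal_sup => _ [I bI <-].
have l0 := ilength_gt0 bI; have p0 : 0 < 2 ^+ n :> R by rewrite exprn_gt0.
have mS := @measurable_strip R n%:Z.
rewrite (powR_mulrn 2 (ltW l0)) lee_pdivrMr ?exprn_gt0//.
have [nI|In] := leP (2 ^+ n) (ilength I).
  have sub : Qbox I `&` @strip R n%:Z `<=` level_range n.
    by move=> z [_]; exact: strip_sub_level_range.
  apply: (le_trans (Qbox_level_le bI nI mS sub)).
  rewrite -(fineK (level_sup_fin n)) -!EFinM lee_fin [leRHS]mulrAC.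
  rewrite ler_wpM2r ?fine_ge0 ?level_sup_ge0// -mulrA ler_pM2l//.
  rewrite (_ : 4 ^- n = (2 ^- n) ^+ 2); last first.
    by rewrite exprVn exprAC; congr ((_ ^+ _)^-1); ring.
  rewrite -exprMn mulrC; apply: ler_eXnr => //.
  by rewrite ler_pdivlMl// mulr1.
rewrite /strip_part (_ : Qbox I `&` strip n = set0) ?measure0.
  by rewrite mule_ge0 ?mule_ge0 ?level_sup_ge0// lee_fin ?mulr_ge0 ?invr_ge0 ?exprn_ge0// ltW.
apply/seteqP; split => z // [[_ /andP[_ zI]] /(strip_sub_level_range n0)].
rewrite /level_range/=; case: (n) n0 In => // k _ In /andP[kz _].
by have := lt_le_trans In (le_trans kz zI); rewrite ltxx.
Qed.

Lemma Qbox_base_le (I : set R) : bounded_interval I -> ilength I = 2 ->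
  (nu (Qbox I) <= 4%:E * level_sup 0)%E.
Proof.
move=> bI lI; have sub : Qbox I `&` setT `<=` level_range 0.
  by move=> z [[_ /=]]; rewrite lI /level_range/= expr1.
have nI : 2 ^+ 0 <= ilength I by rewrite lI expr0 ler1n.
have := Qbox_level_le bI nI measurableT sub.
by rewrite setIT lI expr0 divr1 -natrM.
Qed.

Lemma carleson_testing_le :
  (test_const%:E * carleson_testing alpha nu <= (512 * M ^+ 2)%:E)%E.
Proof.
have w0 n := level_weight_gt0 n; have k0 := test_const_gt0.
have car0 n : (0 <= carleson 2 (strip_part nu n%:Z))%E by apply: carleson_ge0 => A; exact: measure_ge0.
have p0 n : 0 <= n%:R `^ (2 / alpha) :> R by exact: powR_ge0.
have S0 n : (0 <= (level_weight n)%:E * level_sup n)%E.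
  by rewrite mule_ge0 ?level_sup_ge0// lee_fin ltW.
have total : (\sum_(n <oo) (level_weight n)%:E * level_sup n <= (128 * M ^+ 2)%:E)%E.
  apply: lime_le; first by apply: is_cvg_nneseries => n _ _.
  by apply: nearW => K; rewrite big_mkord; exact: sum_level_sup_le.
set s := ereal_sup [set nu (Qbox I) | I in [set I | bounded_interval I /\ ilength I = 2%R]].
have s_le : (s <= 4%:E * level_sup 0)%E.
  by apply: ge_ereal_sup => _ [I [bI lI] <-]; exact: Qbox_base_le.
have term n : (0 < n)%N -> (test_const%:E * ((n%:R `^ (2 / alpha))%:E * carleson 2 (strip_part nu n%:Z)) <=
    4%:E * ((level_weight n)%:E * level_sup n))%E.
  move=> n0; apply: (@le_trans _ _ (test_const%:E * ((n%:R `^ (2 / alpha))%:E * ((2 * 4 ^- n)%:E * level_sup n)))%E).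
    by rewrite lee_wpmul2l ?lee_fin ?(ltW k0)// lee_wpmul2l ?lee_fin// carleson_strip_le.
  rewrite -(fineK (level_sup_fin n)) -!EFinM lee_fin /level_weight.
  rewrite [leRHS](_ : _ = test_const * (n.+1%:R `^ (2 / alpha) * (4 * 4 ^- n * fine (level_sup n)))).
    rewrite ler_pM2l//; apply: ler_pM => //.
    - by rewrite mulr_ge0 ?fine_ge0 ?level_sup_ge0// mulr_ge0// invr_ge0 exprn_ge0.
    - by rewrite ge0_ler_powR ?nnegrE ?divr_ge0// ?(ltW alpha0)// ler_nat.
    - rewrite ler_wpM2r ?fine_ge0 ?level_sup_ge0// ler_wpM2r ?invr_ge0 ?exprn_ge0//.
      by rewrite ler_nat.
  by ring.
have s0 : (0 <= s)%E by exact: base_sup_ge0.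
have A0 n : (0 <= (n%:R `^ (2 / alpha))%:E * carleson 2 (strip_part nu n%:Z))%E.
  by rewrite mule_ge0 ?lee_fin.
rewrite /carleson_testing -/s ge0_muleDr//; last by apply: nneseries_ge0.
rewrite -nneseriesZl//.
apply: (@le_trans _ _ (4%:E * \sum_(n <oo) (level_weight n)%:E * level_sup n)%E); last first.
  rewrite (_ : 512 * M ^+ 2 = 4 * (128 * M ^+ 2)); last by rewrite mulrA -natrM.
  by rewrite EFinM lee_wpmul2l.
rewrite -nneseriesZl// nneseries_recl//; last by move=> n _; rewrite mule_ge0.
rewrite addeC; apply: leeD.
  rewrite /level_weight expr0 invr1 powR1 !mulr1.
  by rewrite muleCA lee_wpmul2l// lee_fin ltW.
rewrite eseries_cond [leRHS]eseries_cond.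
apply: lee_nneseries => [n _ _|n /= n0]; last exact: term.
by rewrite mule_ge0// lee_fin ltW.
Qed.

End lower_bound.

Theorem theorem2p18 (R : realType) (alpha : R) (halpha : 1 < alpha) :
  exists c C : R, [/\ 0 < c, 0 < C &
    forall mu : {measure set (Cborel R) -> \bar R},
      carried_by_Cplus mu -> regular_on_Cplus mu ->
      (Laplace_bounded (Phi alpha) mu <-> (carleson_testing alpha mu < +oo)%E) /\
      (c%:E * carleson_testing alpha mu <= Laplace_opnorm (Phi alpha) mu ^+ 2
         <= C%:E * carleson_testing alpha mu)%E].
Proof.
have [c c0 lower] : exists2 c : R, 0 < c & forall mu (M : R), 0 <= M ->
    Laplace_bound (Phi alpha) mu M ->
    (c%:E * carleson_testing alpha mu <= (M ^+ 2)%:E)%E.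
  exists (512^-1 * test_const); first by rewrite mulr_gt0 ?test_const_gt0// invr_gt0 ltr0Sn.
  move=> mu M M0 LM; rewrite (EFinM _ test_const) -muleA.
  by rewrite lee_pdivrMl ?ltr0Sn// -EFinM; exact: (carleson_testing_le halpha M0 LM).
have [C C0 upper] : exists2 C : R, 0 < C & forall mu (T : R), carried_by_Cplus mu ->
    carleson_testing alpha mu = T%:E ->
    Laplace_bound (Phi alpha) mu (Num.sqrt (C * T)).
  exists upper_const; first exact: upper_const_gt0.
  by move=> mu T muC; exact: Laplace_bound_testing.
exists c, C; split => // mu muC _.
have T0 := carleson_testing_ge0 alpha mu.
have norm0 : (0 <= Laplace_opnorm (Phi alpha) mu)%E.
  by apply: le_ereal_inf_tmp => _ [M [M0 _] <-]; rewrite lee_fin.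
case TE : (carleson_testing alpha mu) => [T| |]; last by move: T0; rewrite TE.
- have T_ge0 : 0 <= T by rewrite -lee_fin -TE.
  have LT := upper mu T muC TE.
  have CT : 0 <= C * T := mulr_ge0 (ltW C0) T_ge0.
  have cT : 0 <= c * T := mulr_ge0 (ltW c0) T_ge0.
  split; first by split => _; [exact: ltry|exists (Num.sqrt (C * T)); [exact: sqrtr_ge0|]].
  rewrite -!EFinM.
  have up : (Laplace_opnorm (Phi alpha) mu <= (Num.sqrt (C * T))%:E)%E.
    by apply: ereal_inf_lbound; exists (Num.sqrt (C * T)) => //; split => //; exact: sqrtr_ge0.
  have lo : ((Num.sqrt (c * T))%:E <= Laplace_opnorm (Phi alpha) mu)%E.
    apply: le_ereal_inf_tmp => _ [M [M0 LM] <-]; have := lower mu M M0 LM.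
    rewrite TE -EFinM !lee_fin => le; rewrite -(ger0_norm M0) -sqrtr_sqr.
    by rewrite ler_sqrt// sqr_ge0.
  move: norm0 up lo; case: (Laplace_opnorm _ _) => [l| |]//.
  rewrite !lee_fin => l0 up lo; rewrite -expr2; apply/andP; split.
    by rewrite -[leLHS]sqr_sqrtr// ler_sqr ?nnegrE ?sqrtr_ge0.
  by rewrite -[leRHS]sqr_sqrtr// ler_sqr ?nnegrE ?sqrtr_ge0.
- have none M : 0 <= M -> ~ Laplace_bound (Phi alpha) mu M.
    by move=> M0 LM; have := lower mu M M0 LM; rewrite TE gt0_muley ?lte_fin.
  split; first by split => // -[M M0 LM]; case: (none _ M0 LM).
  have -> : Laplace_opnorm (Phi alpha) mu = +oo%E.
    rewrite /Laplace_opnorm (_ : [set M%:E | M in _] = set0) ?ereal_inf0//.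
    by apply/seteqP; split => [x [M [M0 LM] _]|x []]; exact: (none _ M0 LM).
  by rewrite expe2 mulyy !gt0_muley ?lte_fin ?lexx.
Qed.
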